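(* Let $n\in\mathbb N$, let $A$ be an $n\times n$ real matrix all of whose (complex) eigenvalues have positive real parts, and let $G:\mathbb R^n\to\mathbb R^n$ be as in the context. Let $f:(0,\infty)\to\mathbb R^n$ be a function that is continuous on $[T_f,\infty)$ for some $T_f\ge 0$. Let $T_0\ge0$ and let $y\in C^1((T_0,\infty),\mathbb R^n)$ be a solution of $y'=-Ay+G(y)+f(t)$ on $(T_0,\infty)$ with $y(t)\to0$ as $t\to\infty$. Let $m_*\in\mathbb Z_+$. Let $(\mu_k)_{k=1}^\infty$ be a divergent, strictly increasing sequence of positive numbers and let $\mathcal S=\{\mu_k:k\in\mathbb N\}$ satisfy $x+x'\in\mathcal S$ for all $x,x'\in\mathcal S$ and, in the case $m_*=0$, also $x+1\in\mathcal S$ for all $x\in\mathcal S$. Let $(n_k)_{k=1}^\infty$ be an increasing sequence (meaning $n_k\le n_{k+1}$) of integers with $n_k\ge m_*$ for all $k$. If $f(t)$ has the asymptotic expansion $$f(t)\sim\sum_{k=1}^\infty\widehat p_k(\widehat{\mathcal L}_{n_k}(t))\,L_{m_*}(t)^{-\mu_k},\qquad\widehat p_k\in\mathcal P^1_{m_*}(n_k,\mathbb R^n)\text{ for }k\in\mathbb N,$$ then the solution $y(t)$ admits an asymptotic expansion $$y(t)\sim\sum_{k=1}^\infty\widehat q_k(\widehat{\mathcal L}_{n_k}(t))\,L_{m_*}(t)^{-\mu_k},\qquad\widehat q_k\in\mathcal P^1_{m_*}(n_k,\mathbb R^n)\text{ for }k\in\mathbb N.$$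
   Context: $\mathbb N=\{1,2,\dots\}$, $\mathbb Z_+=\mathbb N\cup\{0\}$; $|\cdot|$ is the Euclidean norm; $u(t)=\mathcal O(h(t))$ means that there are $T,C>0$ with $|u(t)|\le Ch(t)$ for all $t\ge T$. Assumption on $G$: $G:\mathbb R^n\to\mathbb R^n$ is locally Lipschitz, and there exist functions $G_m:\mathbb R^n\to\mathbb R^n$, $m\ge 2$, each a homogeneous polynomial of degree $m$, such that for any $N\ge2$ there exists $\delta>0$ with $|G(x)-\sum_{m=2}^N G_m(x)|=\mathcal O(|x|^{N+\delta})$ as $x\to0$. Iterated functions: $E_0(t)=t$, $E_{m+1}(t)=e^{E_m(t)}$; $L_{-1}(t)=e^t$, $L_0(t)=t$, $L_{m+1}(t)=\ln L_m(t)$ for $m\in\mathbb Z_+$, $t>E_m(0)$. For $k\in\mathbb Z_+$, $\widehat{\mathcal L}_k(t)=(L_{-1}(t),L_0(t),L_1(t),\ldots,L_k(t))=(e^t,t,\ln t,\ldots,L_k(t))$, which lies in $(0,\infty)^{k+2}$ for $t>E_k(0)$. For $z=(z_{-1},z_0,\ldots,z_k)\in(0,\infty)^{k+2}$ and $\alpha=(\alpha_{-1},\ldots,\alpha_k)$, $z^\alpha=\prod_{j=-1}^kz_j^{\alpha_j}$. For integers $k\ge m\ge0$, $\mathcal P^1_m(k,\mathbb R^n)$ is the collection of functions on $(0,\infty)^{k+2}$ that are finite sums of functions of the form $$z=(z_{-1},z_0,\ldots,z_k)\mapsto z^\alpha\prod_{j=0}^k\sigma_j(\omega_jz_j)\,\xi,$$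 where $\xi\in\mathbb R^n$, $\alpha\in\mathbb R^{k+2}$ with $\alpha_{-1}=\alpha_0=\cdots=\alpha_m=0$, $\omega_j\in\mathbb R$, and for each $j$ either $\sigma_j=\cos$ or $\sigma_j=\sin$. Expansion: for $g:(T,\infty)\to\mathbb R^n$, a divergent, strictly increasing sequence $(\gamma_k)$ of positive numbers and integers $n_k\ge m_*$, $g(t)\sim\sum_{k=1}^\infty\widehat g_k(\widehat{\mathcal L}_{n_k}(t))L_{m_*}(t)^{-\gamma_k}$ with $\widehat g_k\in\mathcal P^1_{m_*}(n_k,\mathbb R^n)$ means: for each $N\in\mathbb N$ there is $\mu>\gamma_N$ such that $|g(t)-\sum_{k=1}^N\widehat g_k(\widehat{\mathcal L}_{n_k}(t))L_{m_*}(t)^{-\gamma_k}|=\mathcal O(L_{m_*}(t)^{-\mu})$. *)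

(* Defs.v *)
From HB Require Import structures.
From mathcomp Require Import all_boot all_order all_algebra.
From mathcomp Require Import complex.
From mathcomp Require Import all_classical all_reals all_analysis.
(* Partially imported: the notations clash with those of MathComp-Analysis. *)
From mathcomp Require mpoly.
Import (canonicals, coercions) mpoly.

Set Implicit Arguments.
Unset Strict Implicit.
Unset Printing Implicit Defensive.

Import Order.TTheory GRing.Theory Num.Theory.
Import numFieldNormedType.Exports.

Local Open Scope classical_set_scope.
Local Open Scope ring_scope.

(* The library norm `|x| on matrices is the sup norm. *)
Definition enorm (R : realType) (n : nat) (x : 'cV[R]_n) : R :=
  Num.sqrt (\sum_(i < n) x i 0 ^+ 2).

Definition O_infty (R : realType) (n : nat) (u : R -> 'cV[R]_n) (h : R -> R) :
    Prop :=
  exists T C : R, [/\ 0 < T, 0 < C &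
    forall t : R, T <= t -> enorm (u t) <= C * h t].

Definition eigenvalues_pos_real_part (R : realType) (n : nat) (A : 'M[R]_n) :
    Prop :=
  forall lambda : R[i],
    eigenvalue (map_mx (real_complex R) A) lambda -> 0 < complex.Re lambda.

Definition locally_Lipschitz (R : realType) (n : nat)
    (G : 'cV[R]_n -> 'cV[R]_n) : Prop :=
  forall x : 'cV[R]_n, exists r K : R, 0 < r /\
    forall u v : 'cV[R]_n, enorm (u - x) < r -> enorm (v - x) < r ->
      enorm (G u - G v) <= K * enorm (u - v).

(* [mpoly.ishomog1 d mpoly.mdeg] is the predicate [d.-homog]; as usual, it
   contains the zero polynomial. *)
Definition homogeneous_poly_map (R : realType) (n d : nat)
    (F : 'cV[R]_n -> 'cV[R]_n) : Prop :=
  exists P : 'I_n -> mpoly.mpoly n R,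
    (forall i, P i \is mpoly.ishomog1 d mpoly.mdeg) /\
    (forall x i, F x i 0 = mpoly.meval (fun j => x j 0) (P i)).

Definition nonlinearity (R : realType) (n : nat)
    (G : 'cV[R]_n -> 'cV[R]_n) : Prop :=
  locally_Lipschitz G /\
  exists Gm : nat -> 'cV[R]_n -> 'cV[R]_n,
    (forall m, (2 <= m)%N -> homogeneous_poly_map m (Gm m)) /\
    (forall N, (2 <= N)%N -> exists delta : R, 0 < delta /\
      exists r C : R, [/\ 0 < r, 0 < C &
        forall x : 'cV[R]_n, enorm x < r ->
          enorm (G x - \sum_(2 <= m < N.+1) Gm m x)
            <= C * enorm x `^ (N%:R + delta)]).

(* L_m for m >= 0. Since [ln] is total ([ln x = 0] for [x <= 0]), [iterln m t]
   is meaningful for t > E_{m-1}(0) only; it is used only as t --> +oo. *)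
Definition iterln (R : realType) (m : nat) (t : R) : R := iter m (@ln R) t.

(* Index shift: entry i of a vector z in R^(k+2) is z_(i-1), so that entry 0 is
   z_(-1); for j >= 0, z_j is entry [lift ord0 j]. *)
Definition Lhat (R : realType) (k : nat) (t : R) : 'rV[R]_k.+2 :=
  \row_(i < k.+2) (if i == 0%N :> nat then expR t else iterln i.-1 t).

Definition positive_orthant (R : realType) (d : nat) : set 'rV[R]_d :=
  [set z | forall i, 0 < z 0 i].

Definition monomial (R : realType) (d : nat) (z alpha : 'rV[R]_d) : R :=
  \prod_(i < d) z 0 i `^ alpha 0 i.

(* The functions under consideration live on the positive orthant; their values
   elsewhere are left unconstrained. *)
Definition P1_term (R : realType) (n m k : nat) : set ('rV[R]_k.+2 -> 'cV[R]_n) :=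
  [set p | exists (xi : 'cV[R]_n) (alpha : 'rV[R]_k.+2) (omega : 'I_k.+1 -> R)
      (sigma : 'I_k.+1 -> R -> R),
    [/\ forall i : 'I_k.+2, (i <= m.+1)%N -> alpha 0 i = 0,
        forall j, sigma j = @cos R \/ sigma j = @sin R &
        {in positive_orthant (R:=R) (d:=k.+2), forall z, p z =
          (monomial z alpha *
           \prod_(j < k.+1) sigma j (omega j * z 0 (lift ord0 j))) *: xi}]].

Definition P1 (R : realType) (n m k : nat) : set ('rV[R]_k.+2 -> 'cV[R]_n) :=
  [set p | exists (s : nat) (F : 'I_s -> 'rV[R]_k.+2 -> 'cV[R]_n),
    (forall i, P1_term m (F i)) /\
    {in positive_orthant (R:=R) (d:=k.+2), forall z, p z = \sum_(i < s) F i z}].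

(* Sequences are indexed from 0: gamma k, ns k, ghat k stand for gamma_(k+1),
   n_(k+1), ghat_(k+1), and the condition at [N] is the usual one at N + 1. *)
Definition expansion (R : realType) (n m : nat) (ns : nat -> nat)
    (gamma : nat -> R) (ghat : forall k, 'rV[R]_(ns k).+2 -> 'cV[R]_n)
    (g : R -> 'cV[R]_n) : Prop :=
  forall N : nat, exists mu : R, gamma N < mu /\
    O_infty
      (fun t => g t - \sum_(k < N.+1)
                  iterln m t `^ (- gamma k) *: ghat k (Lhat (ns k) t))
      (fun t => iterln m t `^ (- mu)).

Definition C1_solution (R : realType) (n : nat) (A : 'M[R]_n)
    (G : 'cV[R]_n -> 'cV[R]_n) (f : R -> 'cV[R]_n) (T0 : R)
    (y : R -> 'cV[R]_n) : Prop :=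
  [/\ forall t, T0 < t -> derivable y t 1,
      {within `]T0, +oo[, continuous (derive1 y)} &
      forall t, T0 < t -> derive1 y t = - (A *m y t) + G (y t) + f t].

(* Main.v *)
(** A quadratic Lyapunov function, obtained from a Schur triangularization of A
    with small off-diagonal part, shows that a solution of w' = -A w + h, where h
    is a small multiple of w plus O(L_m(t)^-nu), is itself O(L_m(t)^-nu). The
    coefficients q_k are found by solving A q + (d/dz_0) q = c in P^1_m, which is
    possible because A + i omega is invertible for every real omega: all other
    variables z_j = L_j(t) evolve with speed O(1/t), so they contribute terms of
    order mu_k + 1 when m = 0 and terms smaller than every power of L_m when
    m > 0. As S is closed under addition, the residual of the partial sum
    Y = q_1 L_m^(-mu_1) + ... + q_N L_m^(-mu_N) is of order mu_(N+1). Comparing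
    y with Y through the stability estimate, the Taylor polynomials of G are
    Lipschitz with small constants near 0 and their remainder is controlled by
    the a priori decay of y, itself another instance of the estimate. *)

Require Import Defs.
From HB Require Import structures.
From mathcomp Require Import all_boot all_order all_algebra.
From mathcomp Require Import complex spectral.
From mathcomp Require Import all_classical all_reals all_analysis.
From mathcomp Require Import ring lra.
From mathcomp Require mpoly.
Import (canonicals, coercions) mpoly.

Set Implicit Arguments.
Unset Strict Implicit.
Unset Printing Implicit Defensive.

Import Order.TTheory GRing.Theory Num.Theory.
Import numFieldNormedType.Exports.

Local Open Scope classical_set_scope.
Local Open Scope ring_scope.

(** * Lyapunov function *)

(** The coefficients may be unbounded: powers of L_j with j > m are allowed, so a term of index k is
    in general only O(L_m^(-mu_k + e)) for every e > 0. Errors are therefore measured at an exponent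
    strictly between two consecutive mu_k. P^1_m consists of functions of z, whereas growth and
    differentiation concern t; the proof works with functions of t generated by powers and
    oscillations of the L_j ([alg]), and returns to P^1_m at the end and where a single oscillation
    in t has to be isolated. No formula for q_N in terms of the p_k and the earlier q_j is written
    down. Functions are graded by the smallest index of their terms ([gr]), and q_N comes from the
    leading coefficient of the residual; all the grading has to know about products is that their
    index exceeds that of each factor. Likewise mu_k <= (k+1) mu_0 lets the power N+2 of |y| beat
    L_m^(-lambda) for lambda < mu_N, although y is at first only known to decay at some rate below
    mu_0. *)

Definition dot (R : realType) (n : nat) (u v : 'cV[R]_n) : R :=
  \sum_i u i 0 * v i 0.

Definition sq (R : realType) (n : nat) (u : 'cV[R]_n) : R := dot u u.

Lemma Re_sum (R : realType) (I : finType) (F : I -> R[i]) :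
  complex.Re (\sum_i F i) = \sum_i complex.Re (F i).
Proof. by apply: (big_morph _ _ erefl) => - [? ?] [? ?]. Qed.

Lemma Im_sum (R : realType) (I : finType) (F : I -> R[i]) :
  complex.Im (\sum_i F i) = \sum_i complex.Im (F i).
Proof. by apply: (big_morph _ _ erefl) => - [? ?] [? ?]. Qed.

Lemma map_Re_mulmx (R : realType) (m n p : nat) (M : 'M[R[i]]_(m, n))
    (N : 'M[R[i]]_(n, p)) :
  map_mx (@complex.Re R) (M *m N) =
  map_mx (@complex.Re R) M *m map_mx (@complex.Re R) N -
  map_mx (@complex.Im R) M *m map_mx (@complex.Im R) N.
Proof.
apply/matrixP => i j; rewrite !mxE Re_sum -sumrB; apply: eq_bigr => k _.
by rewrite !mxE; case: (M i k) (N k j) => [? ?] [? ?].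
Qed.

Lemma map_Im_mulmx (R : realType) (m n p : nat) (M : 'M[R[i]]_(m, n))
    (N : 'M[R[i]]_(n, p)) :
  map_mx (@complex.Im R) (M *m N) =
  map_mx (@complex.Re R) M *m map_mx (@complex.Im R) N +
  map_mx (@complex.Im R) M *m map_mx (@complex.Re R) N.
Proof.
apply/matrixP => i j; rewrite !mxE Im_sum -big_split; apply: eq_bigr => k _.
by rewrite !mxE; case: (M i k) (N k j) => [? ?] [? ?].
Qed.

Lemma map_Re_real (R : realType) (m n : nat) (M : 'M[R]_(m, n)) :
  map_mx (@complex.Re R) (map_mx (real_complex R) M) = M.
Proof. by apply/matrixP => i j; rewrite !mxE. Qed.

Lemma map_Im_real (R : realType) (m n : nat) (M : 'M[R]_(m, n)) :
  map_mx (@complex.Im R) (map_mx (real_complex R) M) = 0.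
Proof. by apply/matrixP => i j; rewrite !mxE. Qed.

Lemma finite_pos_lower_bound (R : realType) (I : finType) (F : I -> R) :
  (forall i, 0 < F i) -> exists2 a, 0 < a & forall i, a <= F i.
Proof.
move=> F0; exists (\big[Num.min/1]_i F i).
  by apply: lt_bigmin.
by move=> i; exact: bigmin_le.
Qed.

Lemma complex_schur (R : realType) (n : nat) (A : 'M[R]_n) : (0 < n)%N ->
  eigenvalues_pos_real_part A ->
  exists P T : 'M[R[i]]_n, [/\ P \in unitmx,
    P *m map_mx (real_complex R) A = T *m P,
    forall i j : 'I_n, (i < j)%N -> T i j = 0 &
    forall i, 0 < complex.Re (T i i)].
Proof.
move=> n0 hA; set AC := map_mx _ A.
have [P Pun Ptr] := Schur AC n0.
have Pu : P \in unitmx by exact: unitarymx_unit.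
exists P, (conjmx P AC); split=> //.
- by rewrite conjumx// mulmxKV.
- by move/is_trig_mxP : Ptr.
(* The diagonal entries of a triangular matrix are roots of its characteristic polynomial, and
   conjugation by [P] preserves eigenvalues. *)
move=> i; apply: hA; apply: (@eigenvalue_conjmx _ _ _ P).
- exact: stablemx_unit.
- by rewrite row_free_unit.
rewrite -[_ \in _]/(eigenvalue _ _) eigenvalue_root_char char_poly_trig//.
rewrite rootE horner_prod; apply/prodf_eq0; exists i => //.
by rewrite !hornerE subrr.
Qed.

Lemma sq_ge0 (R : realType) (n : nat) (u : 'cV[R]_n) : 0 <= sq u.
Proof. by apply: sumr_ge0 => i _; rewrite -expr2 sqr_ge0. Qed.

(** Cauchy-Schwarz against the constant vector 1, by induction: the cross term [2 a s] is at most
    [n a^2 + s^2 / n], which forces the separate case [n = 0]. *)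
Lemma sqr_sum_le (R : realType) (n : nat) (F : 'I_n -> R) :
  (\sum_i F i) ^+ 2 <= n%:R * \sum_i F i ^+ 2.
Proof.
elim: n F => [|n IH] F; first by rewrite !big_ord0 expr0n mulr0.
rewrite !big_ord_recl; have := IH (fun i => F (lift ord0 i)).
set s := \sum_i _; set q := \sum_i _ => h.
have hq : 0 <= q by apply: sumr_ge0 => i _; rewrite sqr_ge0.
have hn : 0 <= n%:R :> R by [].
have [n0|n0] := posnP n.
  have s0 : s = 0 by rewrite /s big1// => i; case: i => i hi; exfalso; rewrite n0 in hi.
  by rewrite s0 addr0 -natr1 (_ : n%:R = 0 :> R) ?n0// add0r mul1r lerDl.
have n0' : 0 < n%:R :> R by rewrite ltr0n.
have : 0 <= (n%:R * F ord0 - s) ^+ 2 / n%:R by rewrite divr_ge0 ?sqr_ge0.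
have -> : (n%:R * F ord0 - s) ^+ 2 / n%:R =
   n%:R * F ord0 ^+ 2 - 2 * F ord0 * s + s ^+ 2 / n%:R by field; rewrite gt_eqF.
have h2 : s ^+ 2 / n%:R <= q by rewrite ler_pdivrMr// mulrC.
rewrite -[n.+1]addn1 natrD; nra.
Qed.

Lemma sq_mulmx_le (R : realType) (p n : nat) (B : 'M[R]_(p, n)) :
  exists2 K, 0 < K & forall x : 'cV[R]_n, sq (B *m x) <= K * sq x.
Proof.
exists (1 + \sum_i \sum_j n%:R * B i j ^+ 2).
  by rewrite ltr_pwDl// sumr_ge0// => i _; rewrite sumr_ge0// => j _;
     rewrite mulr_ge0// sqr_ge0.
move=> x; rewrite mulrDl mul1r -[leLHS]add0r lerD ?sq_ge0// mulr_suml.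
apply: ler_sum => i _; rewrite -expr2 mxE.
apply: le_trans (sqr_sum_le _) _.
rewrite mulr_sumr mulr_suml; apply: ler_sum => j _.
rewrite exprMn mulrA; apply: ler_wpM2l; first by rewrite mulr_ge0// sqr_ge0.
rewrite /sq /dot (bigD1 j)//= -expr2 lerDl sumr_ge0// => k _.
by rewrite -expr2 sqr_ge0.
Qed.

Lemma dotDl (R : realType) n (u v w : 'cV[R]_n) : dot (u + v) w = dot u w + dot v w.
Proof. by rewrite -big_split; apply: eq_bigr => i _; rewrite mxE mulrDl. Qed.

Lemma dotC (R : realType) n (u v : 'cV[R]_n) : dot u v = dot v u.
Proof. by apply: eq_bigr => i _; rewrite mulrC. Qed.

Lemma dotDr (R : realType) n (u v w : 'cV[R]_n) : dot w (u + v) = dot w u + dot w v.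
Proof. by rewrite dotC dotDl !(dotC w). Qed.

Lemma dotNr (R : realType) n (u w : 'cV[R]_n) : dot w (- u) = - dot w u.
Proof. by rewrite -sumrN; apply: eq_bigr => i _; rewrite mxE mulrN. Qed.

Lemma sqD_le (R : realType) n (u v : 'cV[R]_n) : sq (u + v) <= 2 * sq u + 2 * sq v.
Proof.
rewrite !mulr_sumr -big_split; apply: ler_sum => i _ /=.
by rewrite mxE -!expr2; have := sqr_ge0 (u i 0 - v i 0); nra.
Qed.

Lemma dot_col_mx (R : realType) m n (u u' : 'cV[R]_m) (v v' : 'cV[R]_n) :
  dot (col_mx u v) (col_mx u' v') = dot u u' + dot v v'.
Proof.
rewrite /dot big_split_ord; congr (_ + _); apply: eq_bigr => i _.
  by rewrite !col_mxEu.
by rewrite !col_mxEd.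
Qed.

(* Conjugating a lower triangular matrix by diag(1, d, d^2, ...) multiplies the
   entry (i, j) by d^(i - j), so the off-diagonal part can be made as small as
   we like without changing the diagonal. *)
Lemma complex_schur_small (R : realType) (n : nat) (A : 'M[R]_n) : (0 < n)%N ->
  eigenvalues_pos_real_part A -> exists2 a : R, 0 < a & forall e : R, 0 < e ->
  exists P T : 'M[R[i]]_n, [/\ P \in unitmx,
    P *m map_mx (real_complex R) A = T *m P,
    forall i j : 'I_n, i != j ->
      `|complex.Re (T i j)| + `|complex.Im (T i j)| <= e &
    forall i, a <= complex.Re (T i i)].
Proof.
move=> n0 hA; have [P [T [Pu PA T0 Tp]]] := complex_schur n0 hA.
have [a a0 ha] := finite_pos_lower_bound Tp; exists a => // e e0.
pose M := 1 + \sum_i \sum_j (`|complex.Re (T i j)| + `|complex.Im (T i j)|).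
have M1 : 1 <= M.
  by rewrite lerDl sumr_ge0// => i _; rewrite sumr_ge0// => j _; rewrite addr_ge0.
have MT i j : `|complex.Re (T i j)| + `|complex.Im (T i j)| <= M.
  rewrite /M (bigD1 i)//= (bigD1 j)//=.
  have h1 : 0 <= \sum_(k < n | k != j) (`|complex.Re (T i k)| + `|complex.Im (T i k)|).
    by apply: sumr_ge0 => k _; rewrite addr_ge0.
  have h2 : 0 <= \sum_(k < n | k != i) \sum_l (`|complex.Re (T k l)| + `|complex.Im (T k l)|).
    by apply: sumr_ge0 => k _; apply: sumr_ge0 => l _; rewrite addr_ge0.
  lra.
(* Strictly below the diagonal the exponent [i - j] is at least 1 and [d <= 1], so the entries there
   are at most [d * M <= e]. *)
pose d := Num.min 1 (e / M).
have Mp : 0 < M by lra.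
have d0 : 0 < d by rewrite lt_min ltr01 divr_gt0.
have d1 : d <= 1 by rewrite ge_min lexx.
have dM : d * M <= e by rewrite -ler_pdivlMr// ge_min lexx orbT.
pose D := diag_mx (\row_(i < n) (d ^+ i)%:C%C).
(* Above the diagonal the truncated exponent [i - j] is 0, which is harmless because [T i j = 0]
   there. *)
exists (D *m P), (\matrix_(i, j) ((d ^+ (i - j)%N)%:C%C * T i j)); split.
- rewrite unitmx_mul Pu andbT unitmxE det_diag unitfE.
  apply/prodf_neq0 => i _; rewrite mxE fmorph_eq0 expf_eq0 gt_eqF// andbF//.
- rewrite -mulmxA PA mulmxA [RHS]mulmxA; congr (_ *m _).
  apply/matrixP => i j; rewrite mul_diag_mx mul_mx_diag !mxE.
  have [ij|ji] := ltnP i j; first by rewrite T0// !mulr0 mul0r.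
  by rewrite mulrAC -rmorphM -exprD subnK.
- move=> i j ij; rewrite mxE.
  have [lij|ji] := ltnP i j; first by rewrite T0// mulr0 /= normr0 addr0 ltW.
  have {}ji : (j < i)%N by rewrite ltn_neqAle ji andbT; apply: contra ij => /eqP/val_inj->.
  have dp : 0 <= d ^+ (i - j)%N by rewrite exprn_ge0// ltW.
  have -> : complex.Re ((d ^+ (i - j)%N)%:C%C * T i j) = d ^+ (i - j)%N * complex.Re (T i j).
    by case: (T i j) => x z /=; rewrite mul0r subr0.
  have -> : complex.Im ((d ^+ (i - j)%N)%:C%C * T i j) = d ^+ (i - j)%N * complex.Im (T i j).
    by case: (T i j) => x z /=; rewrite mul0r addr0.
  rewrite !normrM -mulrDr ger0_norm//; apply: le_trans dM.
  apply: ler_pM => //.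
  have : (0 < i - j)%N by rewrite subn_gt0.
  case: (i - j)%N => // k _; rewrite exprS ler_piMr ?(ltW d0)//.
  by rewrite exprn_ile1 ?(ltW d0).
- by move=> i; rewrite mxE subnn mul1r.
Qed.

(** The form [sq (B *m x)] is |P x|^2 for the complex triangularizing matrix [P], in real
    coordinates: [B] stacks the real and imaginary parts of [P]. Along x' = -A x its derivative is
    -2 times the [dot] below. *)
Lemma lyapunov_form (R : realType) (n : nat) (A : 'M[R]_n) : (0 < n)%N ->
  eigenvalues_pos_real_part A ->
  exists (p : nat) (B : 'M[R]_(p, n)) (c K : R), [/\ 0 < c, 0 < K,
    forall x, c * sq (B *m x) <= dot (B *m x) (B *m (A *m x)) &
    forall x, sq x <= K * sq (B *m x)].
Proof.
move=> n0 hA; have [a a0 ha] := complex_schur_small n0 hA.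
have n0' : 0 < n%:R :> R by rewrite ltr0n.
(* The off-diagonal entries cost at most [2 n e = a / 2], half of the coercivity [a] of the
   diagonal. *)
pose e := a / (4 * n%:R).
have e0 : 0 < e by rewrite divr_gt0// mulr_gt0.
have [P [T [Pu PA Toff Tdiag]]] := ha e e0.
pose P1 := map_mx (@complex.Re R) P; pose P2 := map_mx (@complex.Im R) P.
pose T1 := map_mx (@complex.Re R) T; pose T2 := map_mx (@complex.Im R) T.
have PA1 : P1 *m A = T1 *m P1 - T2 *m P2.
  by rewrite -map_Re_mulmx -PA map_Re_mulmx map_Re_real map_Im_real mulmx0 subr0.
have PA2 : P2 *m A = T1 *m P2 + T2 *m P1.
  by rewrite -map_Im_mulmx -PA map_Im_mulmx map_Re_real map_Im_real mulmx0 add0r.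
(* This row matrix is a left inverse of [B], since x is the real part of P^-1 P x. *)
have [K K0 hK] := sq_mulmx_le
  (row_mx (map_mx (@complex.Re R) (invmx P)) (- map_mx (@complex.Im R) (invmx P))).
exists (n + n)%N, (col_mx P1 P2), (a / 2), K; split=> //; first by rewrite divr_gt0.
- move=> x; rewrite !mul_col_mx !mulmxA PA1 PA2 mulmxBl mulmxDl -!mulmxA.
  set u := P1 *m x; set v := P2 *m x.
  rewrite /sq !dot_col_mx.
  pose s i := u i 0 ^+ 2 + v i 0 ^+ 2.
  have s0 i : 0 <= s i by rewrite addr_ge0 ?sqr_ge0.
  have -> : dot u u + dot v v = \sum_i s i.
    by rewrite -big_split; apply: eq_bigr => i _; rewrite /s !expr2.
  set S := \sum_i s i.
  have -> : dot u (T1 *m u - T2 *m v) + dot v (T1 *m v + T2 *m u) =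
      \sum_i \sum_j (u i 0 * (T1 i j * u j 0 - T2 i j * v j 0) +
                     v i 0 * (T1 i j * v j 0 + T2 i j * u j 0)).
    rewrite -big_split; apply: eq_bigr => i _ /=.
    rewrite big_split /= -!mulr_sumr; congr (_ * _ + _ * _).
      by rewrite !mxE sumrB.
    by rewrite !mxE big_split.
  (* On the diagonal the contributions of the imaginary part [T2] cancel, so only the real part of
     [T i i] matters. *)
  have H i j : (i == j)%:R * a * s i - e * (s i + s j) <=
      u i 0 * (T1 i j * u j 0 - T2 i j * v j 0) +
      v i 0 * (T1 i j * v j 0 + T2 i j * u j 0).
    have [<-|ij] := eqVneq i j.
      have := s0 i; have : a <= T1 i i by rewrite mxE; exact: Tdiag.
      by rewrite mul1r /s; set x1 := u i 0; set x2 := v i 0; nra.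
    rewrite !mul0r sub0r.
    have : `|T1 i j| + `|T2 i j| <= e by rewrite !mxE; exact: Toff.
    have := s0 i; have := s0 j; rewrite /s.
    set x1 := u i 0; set x2 := v i 0; set y1 := u j 0; set y2 := v j 0.
    set t1 := T1 i j; set t2 := T2 i j.
    move=> hj hi ht.
    have b1 : `|x1 * y1 + x2 * y2| <= (x1 ^+ 2 + x2 ^+ 2 + (y1 ^+ 2 + y2 ^+ 2)).
      have := sqr_ge0 (x1 + y1); have := sqr_ge0 (x1 - y1).
      have := sqr_ge0 (x2 + y2); have := sqr_ge0 (x2 - y2).
      by rewrite ler_norml => *; apply/andP; split; lra.
    have b2 : `|x2 * y1 - x1 * y2| <= (x1 ^+ 2 + x2 ^+ 2 + (y1 ^+ 2 + y2 ^+ 2)).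
      have := sqr_ge0 (x2 + y1); have := sqr_ge0 (x2 - y1).
      have := sqr_ge0 (x1 + y2); have := sqr_ge0 (x1 - y2).
      by rewrite ler_norml => *; apply/andP; split; lra.
    have -> : x1 * (t1 * y1 - t2 * y2) + x2 * (t1 * y2 + t2 * y1) =
      t1 * (x1 * y1 + x2 * y2) + t2 * (x2 * y1 - x1 * y2) by ring.
    rewrite lerNl; apply: le_trans (ler_norm _) _; rewrite normrN.
    apply: le_trans (ler_normD _ _) _; rewrite !normrM.
    set w := (x1 ^+ 2 + x2 ^+ 2 + (y1 ^+ 2 + y2 ^+ 2)) in b1 b2 *.
    have w0 : 0 <= w by rewrite /w; lra.
    apply: le_trans (_ : (`|t1| + `|t2|) * w <= _).
      by rewrite mulrDl lerD// ler_wpM2l.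
    by rewrite ler_wpM2r.
  apply: le_trans (ler_sum _ (fun i _ => ler_sum _ (fun j _ => H i j))).
  have -> : \sum_i \sum_j ((i == j)%:R * a * s i - e * (s i + s j)) =
      a * S - 2 * n%:R * e * S.
    under eq_bigr => i _.
      rewrite sumrB (bigD1 i)//= eqxx mul1r big1 ?addr0; last first.
        by move=> j ji; rewrite eq_sym (negbTE ji) !mul0r.
      rewrite -mulr_sumr big_split /= sumr_const card_ord -/S.
    over.
    rewrite /= sumrB -!mulr_sumr -/S big_split /= sumr_const card_ord.
    rewrite sumrMnl -/S -(mulr_natl S n); ring.
  have -> : 2 * n%:R * e = a / 2 by rewrite /e; field; rewrite gt_eqF.
  lra.
move=> x; apply: le_trans (hK _); rewrite mul_col_mx mul_row_col.
rewrite mulNmx !mulmxA -mulmxBl.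
by rewrite -map_Re_mulmx mulVmx// (_ : map_mx _ 1%:M = 1%:M) ?mul1mx//;
  apply/matrixP => i j; rewrite !mxE; case: eqP.
Qed.

(** * Stability of the linear equation *)

Definition has_deriv (R : realType) (f : R -> R) (t d : R) : Prop :=
  is_derive t 1 f d.

Lemma near_pinftyP (R : realType) (P : R -> Prop) :
  (\forall t \near +oo, P t) <-> exists2 T, 0 < T & forall t, T <= t -> P t.
Proof.
split=> [[M [_ hM]]|[T T0 hT]].
  exists (Num.max M 0 + 1); first by rewrite ltr_pwDr// le_max lexx orbT.
  move=> t ht; apply: hM; apply: lt_le_trans ht.
  by rewrite ltr_pwDr// le_max lexx.
by exists T; split; [exact: num_real|move=> t /ltW; exact: hT].
Qed.

Lemma hder_eq (R : realType) (f : R -> R) (t d d' : R) :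
  has_deriv f t d -> d = d' -> has_deriv f t d'.
Proof. by move=> ? <-. Qed.

Lemma hder_cst (R : realType) (c t : R) : has_deriv (fun=> c : R) t 0.
Proof. exact: is_derive_cst. Qed.

Lemma hder_id (R : realType) (t : R) : has_deriv (fun x => x) t 1.
Proof. exact: is_derive_id. Qed.

Lemma hderD (R : realType) (f g : R -> R) (t df dg : R) :
  has_deriv f t df -> has_deriv g t dg ->
  has_deriv (fun x => f x + g x) t (df + dg).
Proof. exact: is_deriveD. Qed.

Lemma hderB (R : realType) (f g : R -> R) (t df dg : R) :
  has_deriv f t df -> has_deriv g t dg ->
  has_deriv (fun x => f x - g x) t (df - dg).
Proof. exact: is_deriveB. Qed.

Lemma hderM (R : realType) (f g : R -> R) (t df dg : R) :
  has_deriv f t df -> has_deriv g t dg ->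
  has_deriv (fun x => f x * g x) t (df * g t + f t * dg).
Proof.
move=> hf hg; apply: (is_derive_eq (is_deriveM hf hg)).
by rewrite addrC [df * _]mulrC.
Qed.

Lemma hderZ (R : realType) (c : R) (f : R -> R) (t df : R) :
  has_deriv f t df -> has_deriv (fun x => c * f x) t (c * df).
Proof. exact: is_deriveZ. Qed.

Lemma hder_sum (R : realType) (I : finType) (f : I -> R -> R) (t : R)
    (df : I -> R) : (forall i, has_deriv (f i) t (df i)) ->
  has_deriv (fun x => \sum_i f i x) t (\sum_i df i).
Proof.
move=> h; rewrite !unlock /=; elim: (index_enum I) => [|i s IH] /=.
  exact: hder_cst.
exact: hderD.
Qed.

Lemma hder_comp (R : realType) (f g : R -> R) (t df dg : R) :
  has_deriv f (g t) df -> has_deriv g t dg ->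
  has_deriv (fun x => f (g x)) t (df * dg).
Proof. exact: is_derive1_comp. Qed.

(** Gronwall's argument: [psi] loses at most the rate [a / 2], so for large [K1] the multiple
    [K1 * psi] is a supersolution, and (V - K1 psi) e^(a t) is nonincreasing. *)
Lemma scalar_stability (R : realType) (V dV psi dpsi : R -> R) (a K : R) :
  0 < a ->
  (\forall t \near +oo, [/\ has_deriv V t (dV t), dV t <= - a * V t + K * psi t,
     0 < psi t, has_deriv psi t (dpsi t) & - (a / 2) * psi t <= dpsi t]) ->
  exists2 C, 0 < C & \forall t \near +oo, V t <= C * psi t.
Proof.
move=> a0 /near_pinftyP[T T0 H].
(* The summands give in turn positivity, the sign of the derivative, and V <= K1 psi at the initial
   time [T]. *)
pose K1 := 1 + `|2 * K / a| + `|V T / psi T|.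
have K10 : 0 < K1 by rewrite /K1 -addrA ltr_pwDl// addr_ge0.
have K1a : 2 * K / a <= K1.
  by rewrite /K1; have := ler_norm (2 * K / a); have := normr_ge0 (V T / psi T); lra.
have K1V : V T <= K1 * psi T.
  have [_ _ p0 _ _] := H T (lexx _).
  rewrite -ler_pdivrMr// /K1; have := ler_norm (V T / psi T).
  by have := normr_ge0 (2 * K / a); lra.
exists K1 => //; apply/near_pinftyP; exists T => // t Tt.
pose Z x := (V x - K1 * psi x) * expR (a * x).
have dZ x : T <= x -> has_deriv Z x ((dV x - K1 * dpsi x) * expR (a * x) +
     (V x - K1 * psi x) * (expR (a * x) * (a * 1))).
  move=> Tx; have [hV _ _ hp _] := H x Tx.
  apply: hderM; first by apply: hderB => //; exact: hderZ.
  apply: (hder_comp (f := expR)); first exact: is_derive_expR.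
  exact: (hderZ a (hder_id x)).
have : Z t <= Z T.
  apply: (@ler0_derive1_nincry _ Z T) => //.
  - by move=> x; rewrite in_itv /= andbT => /ltW /dZ [].
  - move=> x; rewrite in_itv /= andbT => /ltW Tx.
    have [_ hx] := dZ x Tx; rewrite derive1E hx.
    have [_ hV p0 _ hp] := H x Tx.
    have -> : (dV x - K1 * dpsi x) * expR (a * x) +
      (V x - K1 * psi x) * (expR (a * x) * (a * 1)) =
      (dV x - K1 * dpsi x + a * V x - a * K1 * psi x) * expR (a * x) by ring.
    rewrite pmulr_lle0 ?expR_gt0//.
    have h1 : K * psi x <= (K1 * (a / 2)) * psi x.
      rewrite ler_pM2r//; move: K1a; rewrite ler_pdivrMr//; lra.
    have h2 : K1 * (- (a / 2) * psi x) <= K1 * dpsi x by rewrite ler_pM2l.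
    lra.
  - apply: derivable_within_continuous => x; rewrite in_itv /= andbT.
    by move=> /dZ[].
have ZT : Z T <= 0 by rewrite pmulr_lle0 ?expR_gt0// subr_le0.
move=> /le_trans/(_ ZT); rewrite pmulr_lle0 ?expR_gt0//; lra.
Qed.

(* The last hypothesis says that [psi] decays subexponentially: a faster rate
   could not be inherited by [w]. *)
Lemma linear_stability (R : realType) (n : nat) (A : 'M[R]_n) : (0 < n)%N ->
  eigenvalues_pos_real_part A -> exists e : R, 0 < e /\
  forall (w h : R -> 'cV[R]_n) (psi dpsi : R -> R) (K : R),
    (\forall t \near +oo, forall i,
      has_deriv (fun x => w x i 0) t ((- (A *m w t) + h t) i 0)) ->
    (\forall t \near +oo, sq (h t) <= e * sq (w t) + K * psi t) ->
    (\forall t \near +oo, 0 < psi t /\ has_deriv psi t (dpsi t)) ->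
    (forall a, 0 < a -> \forall t \near +oo, - a * psi t <= dpsi t) ->
  exists2 C, 0 < C & \forall t \near +oo, sq (w t) <= C * psi t.
Proof.
move=> n0 hA; have [p [B [c [K [c0 K0 hB1 hB2]]]]] := lyapunov_form n0 hA.
have [L L0 hL] := sq_mulmx_le B.
(* The Lyapunov form decays at rate [2 * c]. Young's inequality spends [c] on the cross term, and
   with this value the part of [h] proportional to [w] spends [c / 2]; the rate [c / 2] is left. *)
exists (c ^+ 2 / (2 * L * K)); split.
  by rewrite divr_gt0 ?exprn_gt0// !mulr_gt0.
set e := c ^+ 2 / _ => w h psi dpsi M hw hh hpsi hdpsi.
have e0 : 0 < e by rewrite divr_gt0 ?exprn_gt0// !mulr_gt0.
pose v t := B *m w t.
pose dv t := B *m (- (A *m w t) + h t).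
have dvE t : dv t = - (B *m (A *m w t)) + B *m h t.
  by rewrite /dv mulmxDr mulmxN.
suff [C C0 hC] : exists2 C, 0 < C & \forall t \near +oo, sq (v t) <= C * psi t.
  exists (K * C); first exact: mulr_gt0.
  apply: filterS hC => t ht; apply: le_trans (hB2 _) _.
  by rewrite -mulrA ler_pM2l.
apply: (@scalar_stability _ _ (fun t => 2 * dot (v t) (dv t)) _ dpsi (c / 2)
  (L * `|M| / c)); first by rewrite divr_gt0.
have c4 : 0 < c / 2 / 2 by rewrite !divr_gt0.
near=> t.
have [psi0 hdp] : 0 < psi t /\ has_deriv psi t (dpsi t) by near: t.
split=> //.
- have hwt : forall i, has_deriv (fun x => w x i 0) t ((- (A *m w t) + h t) i 0).
    by near: t.
  have hv i : has_deriv (fun x => v x i 0) t (dv t i 0).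
    rewrite /v /dv (_ : (fun x => _) = fun x => \sum_j B i j * w x j 0); last first.
      by apply/funext => x; rewrite mxE.
    by rewrite mxE; apply: hder_sum => j; exact: hderZ.
  apply: hder_eq.
    by apply: hder_sum => i; apply: hderM; exact: hv.
  rewrite /dot mulr_sumr; apply: eq_bigr => i _; ring.
- have h1 := hB1 (w t).
  have h2 : sq (B *m h t) <= L * (e * sq (w t) + `|M| * psi t).
    apply: le_trans (hL _) _; rewrite ler_pM2l//.
    have : sq (h t) <= e * sq (w t) + M * psi t by near: t.
    move/le_trans; apply; rewrite lerD2l ler_pM2r//; exact: ler_norm.
  have h3 : L * (e * sq (w t)) <= c ^+ 2 / 2 * sq (v t).
    apply: le_trans (_ : L * (e * (K * sq (v t))) <= _).
      by rewrite ler_pM2l// ler_pM2l// hB2.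
    rewrite le_eqVlt; apply/orP; left; apply/eqP; rewrite /e; field.
    by rewrite !gt_eqF.
  have h4 : 2 * dot (v t) (B *m h t) <= c * sq (v t) + sq (B *m h t) / c.
    rewrite /sq /dot !mulr_sumr mulr_suml -big_split; apply: ler_sum => i _ /=.
    set x := v t i 0; set z := (B *m h t) i 0.
    have : 0 <= (c * x - z) ^+ 2 / c by rewrite divr_ge0 ?sqr_ge0// ltW.
    have -> : (c * x - z) ^+ 2 / c = c * (x * x) + z * z / c - 2 * (x * z).
      by field; rewrite gt_eqF.
    lra.
  have h5 : sq (B *m h t) / c <= c / 2 * sq (v t) + L * `|M| / c * psi t.
    rewrite ler_pdivrMr//.
    have -> : (c / 2 * sq (v t) + L * `|M| / c * psi t) * c =
      c ^+ 2 / 2 * sq (v t) + L * `|M| * psi t by field; rewrite gt_eqF.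
    lra.
  rewrite dvE dotDr dotNr; rewrite -/(v t) in h1; lra.
- have : - (c / 2 / 2) * psi t <= dpsi t by near: t; exact: hdpsi.
  by [].
Unshelve. all: by end_near. Qed.

(** * Inverting A + i omega in real terms *)

Lemma subr_scalar_mx (K : comNzRingType) (n : nat) (M : 'M[K]_n) (a : K) :
  M *m M - (a * a)%:M = (M - a%:M) *m (M - (- a)%:M).
Proof.
rewrite [(- a)%:M]raddfN opprK mulmxDr !mulmxBl mul_scalar_mx mul_mx_scalar.
by rewrite -scalar_mxM addrA subrK.
Qed.

(** Over the complex numbers A^2 + w^2 = (A - i w)(A + i w), and neither i w nor -i w is an
    eigenvalue of A, as their real parts vanish. *)
Lemma rotation_unitmx (R : realType) (n : nat) (A : 'M[R]_n) (w : R) :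
  eigenvalues_pos_real_part A -> A *m A + (w ^+ 2)%:M \in unitmx.
Proof.
move=> hA; rewrite -(map_unitmx (real_complex R)).
have -> : map_mx (real_complex R) (A *m A + (w ^+ 2)%:M) =
  (map_mx (real_complex R) A - (Complex 0 w)%:M) *m
  (map_mx (real_complex R) A - (- Complex 0 w)%:M).
  rewrite map_mxD map_mxM map_scalar_mx /= -subr_scalar_mx -raddfN; congr (_ + _%:M).
  by apply/eqP; rewrite eq_complex /=; apply/andP; split; apply/eqP; ring.
have eigen z : complex.Re z = 0 -> map_mx (real_complex R) A - z%:M \in unitmx.
  move=> z0; have := hA z; rewrite z0 ltxx.
  rewrite /eigenvalue /eigenspace kermx_eq0 row_free_unit.
  by case: (_ \in _) => // /(_ isT).
by rewrite unitmx_mul !eigen//= oppr0.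
Qed.

(** These are the equations for cos(w t) a + sin(w t) b to solve o' + A o = cos(w t) xc + sin(w t)
    xs. They are solved by Cramer's rule, since the entries of the block system commute with the
    inverse of A^2 + w^2. *)
Lemma rotation_solve (R : realType) (n : nat) (A : 'M[R]_n) (w : R)
    (xc xs : 'cV[R]_n) : eigenvalues_pos_real_part A ->
  exists a b : 'cV[R]_n, A *m a + w *: b = xc /\ A *m b - w *: a = xs.
Proof.
move=> hA; have := rotation_unitmx w hA; set M := _ + _ => Mu.
exists (invmx M *m (A *m xc - w *: xs)), (invmx M *m (A *m xs + w *: xc)).
have AM : A *m invmx M = invmx M *m A.
  have MA : M *m A = A *m M.
    by rewrite mulmxDl mulmxDr mulmxA mul_scalar_mx mul_mx_scalar.
  by rewrite -[LHS](mulKmx Mu) [M *m (A *m _)]mulmxA MA -mulmxA mulmxV// mulmx1.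
split; rewrite mulmxA AM -mulmxA scalemxAr.
- rewrite -mulmxDr (_ : _ + _ = M *m xc) ?mulKmx//.
  rewrite mulmxBr scalerDr scalerA -scalemxAr -expr2 mulmxDl mul_scalar_mx mulmxA.
  by rewrite addrA subrK.
- rewrite -mulmxBr (_ : _ - _ = M *m xs) ?mulKmx//.
  rewrite mulmxDr scalerBr scalerA -scalemxAr -expr2 mulmxDl mul_scalar_mx mulmxA.
  by rewrite opprB addrA addrAC addrK.
Qed.

(** * The algebra of iterated logarithms *)

Lemma iterln_ge (R : realType) (m : nat) (M : R) :
  \forall t \near +oo, M <= iterln m t.
Proof.
elim: m M => [|m IH] M; first exact: (nbhs_pinfty_ge (num_real M)).
apply: filterS (IH (expR M)) => t; rewrite /iterln /= => h.
rewrite -[leLHS]expRK ler_ln ?posrE ?expR_gt0//.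
exact: lt_le_trans (expR_gt0 M) h.
Qed.

Lemma iterln_gt0 (R : realType) (m : nat) : \forall t \near +oo, 0 < iterln m t :> R.
Proof. by apply: filterS (iterln_ge m 1) => t; exact: lt_le_trans ltr01. Qed.

Lemma iterln_le (R : realType) (m j : nat) : (m <= j)%N ->
  \forall t \near +oo, iterln j t <= iterln m t :> R.
Proof.
move=> mj; rewrite -(subnK mj); elim: (j - m)%N => [|i IH].
  by apply: nearW => t; rewrite add0n.
rewrite addSn; near=> t; apply: (le_trans (y := iterln (i + m) t)).
  by rewrite /iterln /= ltW// ln_sublinear//; near: t; exact: iterln_gt0.
by near: t; exact: IH.
Unshelve. all: by end_near. Qed.

Lemma powR_ge1 (R : realType) (x a : R) : 1 <= x -> 0 <= a -> 1 <= x `^ a.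
Proof. by move=> x1 a0; rewrite -(powRr0 x) ler_powR. Qed.

(** Apply ln u <= u to u = x^(e/a) and raise to the power [a]. *)
Lemma ln_powR_le (R : realType) (x a e : R) : 1 <= x -> 0 < a -> 0 < e ->
  ln x `^ a <= (e / a) `^ (- a) * x `^ e.
Proof.
move=> x1 a0 e0; have ea0 : 0 < e / a by rewrite divr_gt0.
have x0 : 0 < x by lra.
apply: le_trans (_ : ((e / a)^-1 * x `^ (e / a)) `^ a <= _).
  rewrite ge0_ler_powR ?nnegrE ?ln_ge0 ?mulr_ge0 ?powR_ge0 ?invr_ge0 ?(ltW ea0) ?(ltW a0)//.
  by rewrite ler_pdivlMl// -ln_powR ltW// ln_sublinear// powR_gt0.
have ea1 : 0 <= (e / a)^-1 by rewrite invr_ge0 ltW.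
rewrite (powRM _ ea1 (powR_ge0 _ _)) -[(x `^ _) `^ _]powRrM divfK ?gt_eqF//.
by rewrite -(powR_inv1 (ltW ea0)) -powRrM mulN1r.
Qed.

Definition bigO (R : realType) (u h : R -> R) : Prop :=
  exists2 C, 0 < C & \forall t \near +oo, `|u t| <= C * h t.

Lemma bigO_pow_iterln (R : realType) (m j : nat) (a e : R) : (m < j)%N -> 0 < e ->
  bigO (fun t => iterln j t `^ a) (fun t => iterln m t `^ e).
Proof.
move=> mj e0; have [a0|a0] := ltP 0 a.
  exists ((e / a) `^ (- a)); first by apply: powR_gt0; exact: divr_gt0.
  near=> t; rewrite ger0_norm ?powR_ge0//.
  have j1 : 1 <= iterln j t by near: t; exact: iterln_ge.
  have m1 : 1 <= iterln m t by near: t; exact: iterln_ge.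
  apply: le_trans (ln_powR_le m1 a0 e0).
  have jm : iterln j t <= ln (iterln m t) by near: t; exact: (iterln_le R mj).
  by rewrite ge0_ler_powR ?nnegrE ?(ltW a0) ?ln_ge0//; lra.
exists 1 => //; near=> t; rewrite ger0_norm ?powR_ge0// mul1r.
have j1 : 1 <= iterln j t by near: t; exact: iterln_ge.
have m1 : 1 <= iterln m t by near: t; exact: iterln_ge.
apply: le_trans (powR_ge1 m1 (ltW e0)).
by rewrite -[leRHS](powRr0 (iterln j t)) ler_powR.
Unshelve. all: by end_near. Qed.

Lemma bigOD (R : realType) (u v h : R -> R) :
  bigO u h -> bigO v h -> bigO (fun t => u t + v t) h.
Proof.
move=> [C C0 hu] [D D0 hv]; exists (C + D); first by rewrite addr_gt0.
by near=> t; rewrite mulrDl (le_trans (ler_normD _ _))// lerD//; near: t.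
Unshelve. all: by end_near. Qed.

Lemma bigON (R : realType) (u h : R -> R) : bigO u h -> bigO (fun t => - u t) h.
Proof. by move=> [C C0 hu]; exists C => //; apply: filterS hu => t; rewrite normrN. Qed.

Lemma bigOM (R : realType) (u v h k : R -> R) :
  bigO u h -> bigO v k -> bigO (fun t => u t * v t) (fun t => h t * k t).
Proof.
move=> [C C0 hu] [D D0 hv]; exists (C * D); first by rewrite mulr_gt0.
by near=> t; rewrite normrM mulrACA ler_pM//; near: t.
Unshelve. all: by end_near. Qed.

Lemma bigO_near (R : realType) (u v h : R -> R) :
  (\forall t \near +oo, u t = v t) -> bigO u h -> bigO v h.
Proof.
by move=> uv [C C0 hu]; exists C => //; apply: filterS2 uv hu => t ->.
Qed.

Lemma bigO_sum (R : realType) (I : Type) (s : seq I) (u : I -> R -> R) (h : R -> R) :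
  (\forall t \near +oo, 0 <= h t) ->
  (forall i, bigO (u i) h) -> bigO (fun t => \sum_(i <- s) u i t) h.
Proof.
move=> h0 hu; elim: s => [|i s IH].
  by exists 1 => //; apply: filterS h0 => t; rewrite big_nil normr0 mul1r.
apply: bigO_near (bigOD (hu i) IH).
by apply: nearW => t; rewrite big_cons.
Qed.

Lemma bigO_iterln_le (R : realType) (m : nat) (u : R -> R) (a b : R) : a <= b ->
  bigO u (fun t => iterln m t `^ a) -> bigO u (fun t => iterln m t `^ b).
Proof.
move=> ab [C C0 hu]; exists C => //; near=> t.
apply: le_trans (_ : C * iterln m t `^ a <= _); first by near: t.
by rewrite ler_pM2l// ler_powR//; near: t; exact: iterln_ge.
Unshelve. all: by end_near. Qed.

Lemma bigO_iterlnM (R : realType) (m : nat) (u v : R -> R) (a b : R) :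
  bigO u (fun t => iterln m t `^ a) -> bigO v (fun t => iterln m t `^ b) ->
  bigO (fun t => u t * v t) (fun t => iterln m t `^ (a + b)).
Proof.
move=> hu hv; have [C C0 huv] := bigOM hu hv; exists C => //.
near=> t; rewrite powRD; first by near: t.
by apply/implyP => _; rewrite gt_eqF//; near: t; exact: iterln_gt0.
Unshelve. all: by end_near. Qed.

Lemma bigO_cst (R : realType) (m : nat) (c a : R) : 0 <= a ->
  bigO (fun=> c) (fun t => iterln m t `^ a).
Proof.
move=> a0; exists (1 + `|c|); first by rewrite ltr_pwDl.
near=> t; have m1 : 1 <= iterln m t by near: t; exact: iterln_ge.
have := powR_ge1 m1 a0; have := normr_ge0 c; nra.
Unshelve. all: by end_near. Qed.

(* With l = 0 these are the functions of the form p(Lhat_k(t)) with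
   p a scalar element of P^1_m(k); l = 1 forbids oscillations in t itself. *)
Inductive alg (R : realType) (l m k : nat) : (R -> R) -> Prop :=
| alg_cst c : alg l m k (fun=> c)
| alg_pow j a : (m < j)%N -> (j <= k)%N -> alg l m k (fun t => iterln j t `^ a)
| alg_cos j w : (l <= j)%N -> (j <= k)%N -> alg l m k (fun t => cos (w * iterln j t))
| alg_sin j w : (l <= j)%N -> (j <= k)%N -> alg l m k (fun t => sin (w * iterln j t))
| algD f g : alg l m k f -> alg l m k g -> alg l m k (fun t => f t + g t)
| algM f g : alg l m k f -> alg l m k g -> alg l m k (fun t => f t * g t).

Lemma alg_weaken (R : realType) (l m k l' m' k' : nat) (f : R -> R) :
  (l' <= l)%N -> (m' <= m)%N -> (k <= k')%N -> alg l m k f -> alg l' m' k' f.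
Proof.
move=> ll mm kk; elim=> [c|j a mj jk|j w lj jk|j w lj jk|{}f g _ hf _ hg|{}f g _ hf _ hg].
- exact: alg_cst.
- by apply: alg_pow; [exact: leq_ltn_trans mj|exact: leq_trans kk].
- by apply: alg_cos; [exact: leq_trans lj|exact: leq_trans kk].
- by apply: alg_sin; [exact: leq_trans lj|exact: leq_trans kk].
- exact: algD.
- exact: algM.
Qed.

Lemma algZ (R : realType) (l m k : nat) (c : R) (f : R -> R) :
  alg l m k f -> alg l m k (fun t => c * f t).
Proof. by move=> hf; apply: algM => //; exact: alg_cst. Qed.

Lemma alg_prod (R : realType) (l m k : nat) (I : Type) (s : seq I)
    (f : I -> R -> R) :
  (forall i, alg l m k (f i)) -> alg l m k (fun t => \prod_(i <- s) f i t).
Proof.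
move=> hf; rewrite !unlock; elim: s => [|i s IH] /=; first exact: alg_cst.
exact: algM.
Qed.

(** Coefficients cost an arbitrarily small power of L_m. The exponent [e] varies in the induction,
    so that a product can split it into halves. *)
Lemma alg_growth (R : realType) (l m k : nat) (f : R -> R) (e : R) :
  alg l m k f -> 0 < e -> bigO f (fun t => iterln m t `^ e).
Proof.
have trig (u : R -> R) e' : 0 <= e' -> (forall t, `|u t| <= 1) ->
    bigO u (fun t => iterln m t `^ e').
  move=> e0 hu; have [C C0 hC] := @bigO_cst R m 1 e' e0; exists C => //.
  by apply: filterS hC => t; rewrite normr1; apply: le_trans.
move=> hf; elim: hf e => [c|j a mj jk|j w lj jk|j w lj jk|{}f g _ hf _ hg|{}f g _ hf _ hg] e e0.
- by apply: bigO_cst; exact: ltW.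
- exact: bigO_pow_iterln.
- by apply: trig; [exact: ltW|move=> t; rewrite ler_norml cos_geN1 cos_le1].
- by apply: trig; [exact: ltW|move=> t; rewrite ler_norml sin_geN1 sin_le1].
- by apply: bigOD; [exact: hf|exact: hg].
- have e2 : 0 < e / 2 by rewrite divr_gt0.
  by rewrite [e]splitr; apply: bigO_iterlnM; [exact: hf|exact: hg].
Qed.

(** Here [c] is 1 / (L_1 ... L_j). *)
Lemma hder_iterln (R : realType) (l j : nat) : exists c : R -> R,
  alg l 0 j c /\ \forall t \near +oo, has_deriv (fun x => iterln j.+1 x) t (c t / t).
Proof.
elim: j => [|j [c [hc dc]]].
  exists (fun=> 1); split; first exact: alg_cst.
  near=> t; rewrite div1r; apply: is_derive1_ln.
  by near: t; exact: (iterln_gt0 R 0).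
exists (fun t => iterln j.+1 t `^ (-1) * c t); split.
  by apply: algM; [exact: alg_pow|exact: alg_weaken hc].
near=> t; have h0 : 0 < iterln j.+1 t by near: t; exact: iterln_gt0.
apply: (@hder_eq _ _ _ ((iterln j.+1 t)^-1 * (c t / t))).
  apply: (@hder_comp _ (@ln R)); first exact: is_derive1_ln.
  by near: t.
by rewrite powR_inv1 ?ltW// mulrA.
Unshelve. all: by end_near. Qed.

(** Every generator is a function of some L_j with j >= 1, whence the factor 1/t. The cofactor may
    contain powers of L_1, ..., L_m coming from the derivatives of the logarithms, so it is only at
    level 0. *)
Lemma alg_deriv (R : realType) (m k : nat) (f : R -> R) : alg 1 m k f ->
  exists r, alg 1 0 k r /\ \forall t \near +oo, has_deriv f t (r t / t).
Proof.
have chain (F dF : R -> R) j : (0 < j)%N -> (j <= k)%N ->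
    alg 1 0 k (fun t => dF (iterln j t)) ->
    (\forall t \near +oo, has_deriv F (iterln j t) (dF (iterln j t))) ->
    exists r, alg 1 0 k r /\
      \forall t \near +oo, has_deriv (fun x => F (iterln j x)) t (r t / t).
  case: j => // j _ jk hF dFj; have [c [hc dc]] := hder_iterln R 1 j.
  exists (fun t => dF (iterln j.+1 t) * c t); split.
    by apply: algM => //; apply: alg_weaken hc => //; exact: ltnW.
  near=> t; apply: hder_eq; last exact: mulrA.
  by apply: hder_comp; near: t.
elim=> [c|j a mj jk|j w lj jk|j w lj jk|{}f g hf [r [hr dr]] hg [q [hq dq]]
       |{}f g hf [r [hr dr]] hg [q [hq dq]]].
- exists (fun=> 0); split; first exact: alg_cst.
  by apply: nearW => t; rewrite mul0r; exact: hder_cst.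
- apply: (chain (fun x => x `^ a) (fun x => a * x `^ (a - 1))) => //.
  + exact: leq_ltn_trans mj.
  + by apply: algZ; apply: alg_pow => //; exact: leq_ltn_trans mj.
  + by near=> t; apply: is_derive1_powR; near: t; exact: iterln_gt0.
- apply: (chain (fun x => cos (w * x)) (fun x => - w * sin (w * x))) => //.
  + by apply: algZ; exact: alg_sin.
  + apply: nearW => t; apply: (@hder_eq _ _ _ (- sin (w * iterln j t) * (w * 1))).
      by apply: hder_comp; [exact: is_derive_cos|exact/hderZ/hder_id].
    by rewrite mulr1; ring.
- apply: (chain (fun x => sin (w * x)) (fun x => w * cos (w * x))) => //.
  + by apply: algZ; exact: alg_cos.
  + apply: nearW => t; apply: (@hder_eq _ _ _ (cos (w * iterln j t) * (w * 1))).
      by apply: hder_comp; [exact: is_derive_sin|exact/hderZ/hder_id].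
    by rewrite mulr1; ring.
- exists (fun t => r t + q t); split; first exact: algD.
  by near=> t; rewrite mulrDl; apply: hderD; near: t.
- exists (fun t => r t * g t + f t * q t); split.
    by apply: algD; apply: algM => //; [apply: alg_weaken hg|apply: alg_weaken hf].
  near=> t; apply: (@hder_eq _ _ _ (r t / t * g t + f t * (q t / t))); last by ring.
  by apply: hderM; near: t.
Unshelve. all: by end_near. Qed.

(** For m > 0 any power of L_m itself belongs to the algebra at level 0, so [c] times such a power
    is still O(t). *)
Lemma alg_div_negligible (R : realType) (m k : nat) (c : R -> R) (a : R) :
  (0 < m)%N -> alg 0 0 k c -> bigO (fun t => c t / t) (fun t => iterln m t `^ a).
Proof.
move=> m0 hc.
have h : alg 0 0 (maxn k m) (fun t => c t * iterln m t `^ (- a)).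
  apply: algM; first by apply: alg_weaken hc => //; exact: leq_maxl.
  by apply: alg_pow => //; exact: leq_maxr.
have [C C0 hC] := alg_growth h ltr01; exists C => //; near=> t.
have t0 : 0 < t by near: t; exact: (iterln_gt0 R 0).
have L0 : 0 < iterln m t by near: t; exact: iterln_gt0.
have : `|c t * iterln m t `^ (- a)| <= C * iterln 0 t `^ 1 by near: t.
rewrite (powRr1 (ltW t0)) powRN normrM normrV ?unitfE ?gt_eqF ?powR_gt0//.
rewrite (ger0_norm (powR_ge0 _ _)) ler_pdivrMr ?powR_gt0// => h'.
rewrite normrM normrV ?unitfE ?gt_eqF// (gtr0_norm t0) ler_pdivrMr//.
by rewrite mulrAC.
Unshelve. all: by end_near. Qed.

(** * The class P^1_m along Lhat *)

Lemma Lhat_lift (R : realType) (k : nat) (t : R) (j : 'I_k.+1) :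
  Lhat k t 0 (lift ord0 j) = iterln j t.
Proof. by rewrite mxE. Qed.

Lemma Lhat_pos (R : realType) (k : nat) :
  \forall t \near +oo, Lhat k t \in positive_orthant (R := R) (d := k.+2).
Proof.
have : \forall t \near +oo, forall i : 'I_k.+2, 0 < Lhat k t 0 i :> R.
  apply: filter_forall => i; near=> t.
  rewrite mxE; case: eqP => [_|_]; first exact: expR_gt0.
  by near: t; exact: iterln_gt0.
by apply: filterS => t h; rewrite inE.
Unshelve. all: by end_near. Qed.

(** Isolates the oscillation in t, the only factor whose derivative is not of order 1/t up to
    logarithms; the remaining factor [s] is covered by [alg_deriv]. *)
Lemma P1_term_Lhat (R : realType) (n m k : nat) (p : 'rV[R]_k.+2 -> 'cV[R]_n) :
  P1_term m p -> exists (sg : R -> R) (w : R) (s : R -> R) (xi : 'cV[R]_n),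
  [/\ sg = @cos R \/ sg = @sin R, alg 1 m k s &
    \forall t \near +oo, p (Lhat k t) = (sg (w * t) * s t) *: xi].
Proof.
move=> [xi [alpha [omega [sigma [halpha hsigma hp]]]]].
exists (sigma ord0), (omega ord0), (fun t => monomial (Lhat k t) alpha *
  \prod_(j < k) sigma (lift ord0 j) (omega (lift ord0 j) * iterln j.+1 t)), xi.
split=> //.
  apply: algM; rewrite /monomial; apply: alg_prod => i.
    (* By the index shift, entries up to [m.+1] are z_(-1), ..., z_m, whose exponents vanish; in
       particular no power of e^t survives. *)
    have [im|mi] := leqP i m.+1.
      rewrite halpha// (_ : (fun t => _) = fun=> 1); first exact: alg_cst.
      by apply/funext => t; rewrite powRr0.
    rewrite (_ : (fun t => _) = fun t => iterln i.-1 t `^ alpha 0 i).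
      apply: alg_pow; first by move: mi; case: (nat_of_ord i).
      by rewrite -ltnS -ltnS prednK//; exact: leq_trans mi.
    by apply/funext => t; rewrite mxE; case: eqP => // i0; rewrite i0 in mi.
  by case: (hsigma (lift ord0 i)) => ->; [apply: alg_cos|apply: alg_sin] => //=; exact: ltn_ord.
apply: filterS (Lhat_pos R k) => t ht.
rewrite hp// big_ord_recl mulrCA Lhat_lift; congr ((_ * (_ * _)) *: _).
by apply: eq_bigr => j _; rewrite Lhat_lift.
Qed.

(** An induction principle on the terms of a sum; it serves both to enter the algebra of functions
    of t and to solve the linear equation term by term. *)
Lemma P1_Lhat_ind (R : realType) (n m k : nat) (p : 'rV[R]_k.+2 -> 'cV[R]_n)
    (Q : (R -> 'cV[R]_n) -> Prop) :
  Q (fun=> 0) ->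
  (forall u v, Q u -> Q v -> Q (fun t => u t + v t)) ->
  (forall u v : R -> 'cV[R]_n, (\forall t \near +oo, u t = v t) -> Q u -> Q v) ->
  (forall (sg : R -> R) w s xi, sg = @cos R \/ sg = @sin R -> alg 1 m k s ->
     Q (fun t => (sg (w * t) * s t) *: xi)) ->
  P1 m p -> Q (fun t => p (Lhat k t)).
Proof.
move=> Q0 QD Qext Qterm [s [F [hF hp]]].
apply: (Qext (fun t => \sum_(i < s) F i (Lhat k t))).
  by apply: filterS (Lhat_pos R k) => t ht; rewrite hp.
elim: s F hF {hp} => [|s IH] F hF.
  by apply: (Qext _ _ _ Q0); apply: nearW => t; rewrite big_ord0.
apply: (Qext _ _ _ (QD _ _ _ (IH (fun i => F (lift ord0 i)) _))); last first.
- by move=> i; exact: hF.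
- have [sg [w [g [xi [hsg hg e]]]]] := P1_term_Lhat (hF ord0).
  by apply: (Qext _ _ _ (Qterm sg w g xi hsg hg)); apply: filterS e => t e; rewrite -e.
- by apply: nearW => t; rewrite big_ord_recl.
Qed.

Definition algv (R : realType) (n l m k : nat) (g : R -> 'cV[R]_n) : Prop :=
  forall i, alg l m k (fun t => g t i 0).

Lemma P1_Lhat_algv (R : realType) (n m k : nat) (p : 'rV[R]_k.+2 -> 'cV[R]_n) :
  P1 m p -> exists2 g, algv 0 m k g & \forall t \near +oo, p (Lhat k t) = g t.
Proof.
pose Q u := exists2 g : R -> 'cV[R]_n, algv 0 m k g & \forall t \near +oo, u t = g t.
apply: (P1_Lhat_ind (Q := Q)) => [|u v [g hg ug] [h hh vh]|u v uv [g hg ug]|sg w s xi hsg hs].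
- exists (fun=> 0); last exact: nearW.
  by move=> i; exact: alg_cst.
- exists (fun t => g t + h t); last by apply: filterS2 ug vh => t -> ->.
  move=> i; rewrite (_ : (fun t => _) = fun t => g t i 0 + h t i 0).
    exact: algD.
  by apply/funext => t; rewrite mxE.
- by exists g => //; apply: filterS2 uv ug => t <-.
- exists (fun t => (sg (w * t) * s t) *: xi); last exact: nearW.
  move=> i; rewrite (_ : (fun t => _) = fun t => sg (w * t) * s t * xi i 0).
    apply: algM; last exact: alg_cst; apply: algM.
      by case: hsg => ->; [apply: (@alg_cos R 0 m k 0)|apply: (@alg_sin R 0 m k 0)].
    by apply: alg_weaken hs.
  by apply/funext => t; rewrite mxE.
Qed.

Lemma P1_ext (R : realType) (n m k : nat) (p q : 'rV[R]_k.+2 -> 'cV[R]_n) :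
  {in positive_orthant (R := R) (d := k.+2), forall z, p z = q z} ->
  P1 m p -> P1 m q.
Proof.
by move=> pq [s [F [hF hp]]]; exists s, F; split=> // z hz; rewrite -pq// hp.
Qed.

Lemma P1_of_term (R : realType) (n m k : nat) (p : 'rV[R]_k.+2 -> 'cV[R]_n) :
  P1_term m p -> P1 m p.
Proof.
by move=> hp; exists 1%N, (fun=> p); split=> // z _; rewrite big_ord_recl big_ord0 addr0.
Qed.

Lemma P1_0 (R : realType) (n m k : nat) : P1 m (fun=> 0 : 'cV[R]_n) (k := k).
Proof. by exists 0%N, (fun=> fun=> 0); split=> [[]|z _]//; rewrite big_ord0. Qed.

Lemma P1_D (R : realType) (n m k : nat) (p q : 'rV[R]_k.+2 -> 'cV[R]_n) :
  P1 m p -> P1 m q -> P1 m (fun z => p z + q z).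
Proof.
move=> [s [F [hF hp]]] [r [H [hH hq]]].
exists (s + r)%N, (fun i => match fintype.split i with inl j => F j | inr j => H j end).
split=> [i|z hz]; first by case: fintype.split.
rewrite hp// hq// big_split_ord; congr (_ + _); apply: eq_bigr => i _.
  by rewrite -[lshift r i]/(unsplit (inl i)) unsplitK.
by rewrite -[rshift s i]/(unsplit (inr i)) unsplitK.
Qed.

Lemma P1_sum (R : realType) (n m k s : nat) (F : 'I_s -> 'rV[R]_k.+2 -> 'cV[R]_n) :
  (forall i, P1 m (F i)) -> P1 m (fun z => \sum_i F i z).
Proof.
elim: s F => [|s IH] F hF.
  by apply: P1_ext (P1_0 _ _ _ _) => z _; rewrite big_ord0.
by apply: P1_ext (P1_D (hF ord0) (IH (fun i => F (lift ord0 i)) _)) => // z _;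
  rewrite big_ord_recl.
Qed.

Lemma P1_scale (R : realType) (n m k : nat) (phi : 'rV[R]_k.+2 -> R) :
  (forall F : 'rV[R]_k.+2 -> 'cV[R]_n, P1_term m F -> P1 m (fun z => phi z *: F z)) ->
  forall p : 'rV[R]_k.+2 -> 'cV[R]_n, P1 m p -> P1 m (fun z => phi z *: p z).
Proof.
move=> h p [s [F [hF hp]]].
apply: P1_ext (P1_sum (fun i => h _ (hF i))) => z hz.
by rewrite hp// scaler_sumr.
Qed.

Lemma P1_cst (R : realType) (n m k : nat) (xi : 'cV[R]_n) :
  P1 m (fun=> xi) (k := k).
Proof.
apply: P1_of_term; exists xi, 0, (fun=> 0), (fun=> @cos R).
split=> [i _|j|z _]; [by rewrite mxE|by left|].
rewrite /monomial !big1 ?mul1r ?scale1r// => i _; first by rewrite mul0r cos0.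
by rewrite mxE powRr0.
Qed.

Lemma P1_pow (R : realType) (n m k : nat) (j : 'I_k.+1) (a : R) : (m < j)%N ->
  forall p : 'rV[R]_k.+2 -> 'cV[R]_n,
  P1 m p -> P1 m (fun z => (z 0 (lift ord0 j) `^ a) *: p z).
Proof.
move=> mj; apply: P1_scale => F [xi [alpha [omega [sigma [halpha hsigma hF]]]]].
apply: P1_of_term; exists xi, (alpha + a *: delta_mx 0 (lift ord0 j)), omega, sigma.
split=> // [i im|z hz].
  rewrite !mxE halpha// eqxx /=; case: eqP => [ij|_]; last by rewrite mulr0 addr0.
  by move: im; rewrite ij lift0 ltnS leqNgt mj.
rewrite hF// scalerA mulrA; congr ((_ * _) *: _).
rewrite /monomial (bigD1 (lift ord0 j))//= [RHS](bigD1 (lift ord0 j))//= mulrA.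
rewrite !mxE !eqxx mulr1 addrC powRD; last first.
  by apply/implyP => _; rewrite gt_eqF//; move: hz; rewrite inE; apply.
congr (_ * _); apply: eq_bigr => i ij; rewrite !mxE (negbTE ij) andbF mulr0 addr0//.
Qed.

Lemma trig_mul (R : realType) (sg tau : R -> R) :
  sg = @cos R \/ sg = @sin R -> tau = @cos R \/ tau = @sin R ->
  exists (rho : R -> R) (c d : R), (rho = @cos R \/ rho = @sin R) /\
    forall x y, sg x * tau y = c * rho (x + y) + d * rho (x - y).
Proof.
move=> [->|->] [->|->].
- exists (@cos R), 2^-1, 2^-1; split; first by left.
  by move=> x y; rewrite cosD cosB; field.
- exists (@sin R), 2^-1, (- 2^-1); split; first by right.
  by move=> x y; rewrite sinD sinB; field.
- exists (@sin R), 2^-1, 2^-1; split; first by right.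
  by move=> x y; rewrite sinD sinB; field.
- exists (@cos R), (- 2^-1), 2^-1; split; first by left.
  by move=> x y; rewrite cosD cosB; field.
Qed.

(** A term holds one sine or cosine per variable, so a second one is merged by the product-to-sum
    formulas, producing the two frequencies omega_j + w and omega_j - w. *)
Lemma P1_trig (R : realType) (n m k : nat) (j : 'I_k.+1) (tau : R -> R) (w : R) :
  tau = @cos R \/ tau = @sin R -> forall p : 'rV[R]_k.+2 -> 'cV[R]_n,
  P1 m p -> P1 m (fun z => tau (w * z 0 (lift ord0 j)) *: p z).
Proof.
move=> htau; apply: P1_scale => F [xi [alpha [omega [sigma [halpha hsigma hF]]]]].
have [rho [c [d [hrho hmul]]]] := trig_mul (hsigma j) htau.
pose G (e v : R) z := (monomial z alpha * \prod_(i < k.+1)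
  (if i == j then rho else sigma i)
    ((if i == j then omega j + v else omega i) * z 0 (lift ord0 i))) *: (e *: xi).
have hG e v : P1 m (G e v).
  apply: P1_of_term; exists (e *: xi), alpha,
    (fun i => if i == j then omega j + v else omega i),
    (fun i => if i == j then rho else sigma i).
  by split=> // i; case: ifP.
apply: P1_ext (P1_D (hG c w) (hG d (- w))) => z hz.
rewrite hF// /G !scalerA -scalerDl; congr (_ *: _).
rewrite !(bigD1 j (P := predT))//= !eqxx.
have E v : \prod_(i < k.+1 | i != j) (if i == j then rho else sigma i)
    ((if i == j then omega j + v else omega i) * z 0 (lift ord0 i)) =
    \prod_(i < k.+1 | i != j) sigma i (omega i * z 0 (lift ord0 i)).
  by apply: eq_bigr => i /negbTE ->.
rewrite !E; set P := \prod_(i < _ | _) _; set x := z 0 _; set M := monomial _ _.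
have := hmul (omega j * x) (w * x); rewrite -mulrDl -mulrBl.
set A := rho _; set B := rho _; set S := sigma _ _; set T := tau _ => h.
transitivity (M * P * (c * A + d * B)); first ring.
by rewrite -h; ring.
Qed.

(** Letting [f] act on an arbitrary element of P^1_m turns the product case into composition, so
    products of two sums of terms are never expanded. *)
Lemma alg_P1_scale (R : realType) (n m k : nat) (f : R -> R) : alg 0 m k f ->
  forall p : 'rV[R]_k.+2 -> 'cV[R]_n, P1 m p -> exists2 q, P1 m q &
    \forall t \near +oo, q (Lhat k t) = f t *: p (Lhat k t).
Proof.
elim=> [c|j a mj jk|j w lj jk|j w lj jk|{}f g _ hf _ hg|{}f g _ hf _ hg] p hp.
- exists (fun z => c *: p z); last exact: nearW.
  apply: (P1_scale (phi := fun=> c)) hp => F [xi [alpha [omega [sigma [? ? hF]]]]].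
  apply: P1_of_term; exists (c *: xi), alpha, omega, sigma; split=> // z hz.
  by rewrite hF// !scalerA mulrC.
- exists (fun z : 'rV[R]_k.+2 => z 0 (lift ord0 (Ordinal (jk : j < k.+1)%N)) `^ a *: p z).
    exact: P1_pow.
  by apply: nearW => t; rewrite Lhat_lift.
- exists (fun z : 'rV[R]_k.+2 => cos (w * z 0 (lift ord0 (Ordinal (jk : j < k.+1)%N))) *: p z).
    by apply: P1_trig hp; left.
  by apply: nearW => t; rewrite Lhat_lift.
- exists (fun z : 'rV[R]_k.+2 => sin (w * z 0 (lift ord0 (Ordinal (jk : j < k.+1)%N))) *: p z).
    by apply: P1_trig hp; right.
  by apply: nearW => t; rewrite Lhat_lift.
- have [q hq eq] := hf p hp; have [r hr er] := hg p hp.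
  exists (fun z => q z + r z); first exact: P1_D.
  by apply: filterS2 eq er => t -> ->; rewrite scalerDl.
- have [q hq eq] := hg p hp; have [r hr er] := hf q hq.
  exists r => //; apply: filterS2 eq er => t e1 e2.
  by rewrite e2 e1 scalerA.
Qed.

Lemma algv_P1 (R : realType) (n m k : nat) (g : R -> 'cV[R]_n) : algv 0 m k g ->
  exists2 p, P1 m p & \forall t \near +oo, p (Lhat k t) = g t.
Proof.
move=> hg.
have /choice[p hp] : forall i : 'I_n, exists p, P1 m p /\
    \forall t \near +oo, p (Lhat k t) = g t i 0 *: delta_mx i 0.
  move=> i; have [p hp ep] := alg_P1_scale (hg i) (P1_cst m k (delta_mx i 0)).
  by exists p.
exists (fun z => \sum_i p i z); first by apply: P1_sum => i; exact: (hp i).1.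
have : \forall t \near +oo, forall i, p i (Lhat k t) = g t i 0 *: delta_mx i 0.
  by apply: filter_forall => i; exact: (hp i).2.
apply: filterS => t h; rewrite (eq_bigr _ (fun i _ => h i)).
apply/colP => i; rewrite summxE (bigD1 i)//= big1 => [|j ji].
  by rewrite !mxE !eqxx mulr1 addr0.
by rewrite !mxE eq_sym (negbTE ji) mulr0.
Qed.

(** For a term s(t) (cos(w t) xc + sin(w t) xs) one takes h = s o, where o solves the equation with
    [s] replaced by 1. What remains is s' o, of the form r/t. *)
Lemma algv_solve (R : realType) (n m k : nat) (A : 'M[R]_n) (g : R -> 'cV[R]_n) :
  eigenvalues_pos_real_part A -> algv 0 m k g ->
  exists h r : R -> 'cV[R]_n, [/\ algv 0 m k h, algv 0 0 k r &
    \forall t \near +oo, forall i, has_deriv (fun x => h x i 0) t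
      ((- (A *m h t) + g t) i 0 + r t i 0 / t)].
Proof.
(* An element of [alg] may multiply several oscillations in t; in the form P^1_m each term has just
   one. *)
move=> hA hg; have [p hp ep] := algv_P1 hg.
pose Q (u : R -> 'cV[R]_n) := exists h r : R -> 'cV[R]_n,
  [/\ algv 0 m k h, algv 0 0 k r &
    \forall t \near +oo, forall i, has_deriv (fun x => h x i 0) t
      ((- (A *m h t) + u t) i 0 + r t i 0 / t)].
have Qext (u v : R -> 'cV[R]_n) : (\forall t \near +oo, u t = v t) -> Q u -> Q v.
  move=> uv [h [r [hh hr d]]]; exists h, r; split=> //.
  by apply: filterS2 uv d => t <-.
suff /Qext : Q (fun t => p (Lhat k t)) by apply.
apply: P1_Lhat_ind hp => // [|u v [h [r [hh hr dh]]] [h' [r' [hh' hr' dh']]]|sg w s xi hsg hs].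
- exists (fun=> 0), (fun=> 0).
  have a0 k' m' : algv 0 m' k' (fun=> 0 : 'cV[R]_n).
    by move=> i; exact: alg_cst.
  split=> //; apply: nearW => t i.
  by rewrite mulmx0 oppr0 addr0 !mxE mul0r addr0; exact: hder_cst.
- have aD m' (f f' : R -> 'cV[R]_n) : algv 0 m' k f -> algv 0 m' k f' ->
      algv 0 m' k (fun t => f t + f' t).
    move=> hf hf' i; rewrite (_ : (fun t => _) = fun t => f t i 0 + f' t i 0).
      exact: algD.
    by apply/funext => t; rewrite mxE.
  exists (fun t => h t + h' t), (fun t => r t + r' t); split; [exact: aD|exact: aD|].
  apply: filterS2 dh dh' => t d d' i.
  rewrite (_ : (fun x => _) = fun x => h x i 0 + h' x i 0); last first.
    by apply/funext => x; rewrite mxE.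
  apply: hder_eq (hderD (d i) (d' i)) _.
  by rewrite mulmxDr !mxE; ring.
have [rs [hrs drs]] := alg_deriv hs.
have [xc [xs exi]] : exists xc xs : 'cV[R]_n, forall t,
    sg (w * t) *: xi = cos (w * t) *: xc + sin (w * t) *: xs.
  case: hsg => ->; [exists xi, 0|exists 0, xi] => t.
    by rewrite scaler0 addr0.
  by rewrite scaler0 add0r.
have [a [b [ea eb]]] := rotation_solve w xc xs hA.
pose o t := cos (w * t) *: a + sin (w * t) *: b.
have ho m' : algv 0 m' k o.
  move=> i; rewrite (_ : (fun t => _) = fun t => cos (w * iterln 0 t) * a i 0
     + sin (w * iterln 0 t) * b i 0); last by apply/funext => t; rewrite !mxE.
  apply: algD; apply: algM; [exact: alg_cos|exact: alg_cst|exact: alg_sin|exact: alg_cst].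
exists (fun t => s t *: o t), (fun t => rs t *: o t); split.
- move=> i; rewrite (_ : (fun t => _) = fun t => s t * o t i 0).
    by apply: algM; [exact: alg_weaken hs|exact: ho].
  by apply/funext => t; rewrite [LHS]mxE.
- move=> i; rewrite (_ : (fun t => _) = fun t => rs t * o t i 0).
    by apply: algM; [exact: alg_weaken hrs|exact: ho].
  by apply/funext => t; rewrite [LHS]mxE.
apply: filterS drs => t drs i.
have dox : has_deriv (fun x => o x i 0) t
    (- sin (w * t) * (w * 1) * a i 0 + cos (w * t) * (w * 1) * b i 0).
  rewrite (_ : (fun x => _) = fun x => a i 0 * cos (w * x) + b i 0 * sin (w * x)).
    rewrite [_ * a i 0]mulrC [_ * b i 0]mulrC.
    by apply: hderD; apply: hderZ; apply: hder_comp;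
      [exact: is_derive_cos|exact/hderZ/hder_id|exact: is_derive_sin|exact/hderZ/hder_id].
  by apply/funext => x; rewrite !mxE mulrC [X in _ + X]mulrC.
rewrite [X in has_deriv X](_ : _ = fun x => s x * o x i 0); last first.
  by apply/funext => x; rewrite [LHS]mxE.
apply: hder_eq (hderM drs dox) _.
have -> : (sg (w * t) * s t) *: xi = s t *: (cos (w * t) *: xc + sin (w * t) *: xs).
  by rewrite -exi scalerA mulrC.
rewrite -ea -eb /o -scalemxAr mulmxDr -!scalemxAr.
move: (A *m a) (A *m b) => Aa Ab; rewrite !mxE; ring.
Qed.

(** * Graded functions and homogeneous polynomials *)

Record expansion_scale (R : realType) (m : nat) (mu : nat -> R) (ns : nat -> nat) :
    Prop := ExpansionScale {
  scale_gt0 : forall k, 0 < mu k;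
  scale_mono : {mono mu : i j / (i <= j)%N >-> i <= j};
  scale_add : forall i j, exists k, mu k = mu i + mu j;
  scale_add1 : m = 0%N -> forall i, exists k, mu k = mu i + 1;
  scale_ns : forall i j, (i <= j)%N -> (ns i <= ns j)%N;
  scale_ns_ge : forall k, (m <= ns k)%N }.

(* The last constructor makes the grading blind to errors that are smaller than
   every power of L_m; these are the 1/t terms when m > 0. *)
Inductive gr (R : realType) (m : nat) (mu : nat -> R) (ns : nat -> nat) (N : nat) :
    (R -> R) -> Prop :=
| gr_term k c : (N <= k)%N -> alg 0 m (ns k) c ->
    gr m mu ns N (fun t => iterln m t `^ (- mu k) * c t)
| grD u v : gr m mu ns N u -> gr m mu ns N v -> gr m mu ns N (fun t => u t + v t)
| gr_ext u v : (forall a, bigO (fun t => u t - v t) (fun t => iterln m t `^ a)) ->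
    gr m mu ns N u -> gr m mu ns N v.

Lemma bigO_near0 (R : realType) (m : nat) (u : R -> R) (a : R) :
  (\forall t \near +oo, u t = 0) -> bigO u (fun t => iterln m t `^ a).
Proof.
move=> u0; exists 1 => //; apply: filterS u0 => t ->.
by rewrite normr0 mul1r powR_ge0.
Qed.

Lemma gr_near (R : realType) (m : nat) (mu : nat -> R) (ns : nat -> nat) (N : nat)
    (u v : R -> R) :
  (\forall t \near +oo, u t = v t) -> gr m mu ns N u -> gr m mu ns N v.
Proof.
move=> uv; apply: gr_ext => a; apply: bigO_near0.
by apply: filterS uv => t ->; rewrite subrr.
Qed.

Lemma gr0 (R : realType) (m : nat) (mu : nat -> R) (ns : nat -> nat) (N : nat) :
  gr m mu ns N (fun=> 0).
Proof.
apply: gr_near (gr_term mu (leqnn N) (alg_cst 0 m (ns N) 0)).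
by apply: nearW => t; rewrite mulr0.
Qed.

Lemma gr_negligible (R : realType) (m : nat) (mu : nat -> R) (ns : nat -> nat)
    (N : nat) (u : R -> R) :
  (forall a, bigO u (fun t => iterln m t `^ a)) -> gr m mu ns N u.
Proof.
move=> h; apply: gr_ext (gr0 _ _ _ _) => a.
by apply: bigO_near (bigON (h a)); apply: nearW => t; rewrite sub0r.
Qed.

Lemma gr_weaken (R : realType) (m : nat) (mu : nat -> R) (ns : nat -> nat)
    (N N' : nat) (u : R -> R) : (N' <= N)%N -> gr m mu ns N u -> gr m mu ns N' u.
Proof.
move=> NN; elim=> [k c Nk hc|{}u v _ hu _ hv|{}u v uv _ hu].
- by apply: gr_term => //; exact: leq_trans Nk.
- exact: grD.
- exact: gr_ext hu.
Qed.

Lemma grZ (R : realType) (m : nat) (mu : nat -> R) (ns : nat -> nat) (N : nat)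
    (u : R -> R) (a : R) : gr m mu ns N u -> gr m mu ns N (fun t => a * u t).
Proof.
elim=> [k c Nk hc|{}u v _ hu _ hv|{}u v uv _ hu].
- apply: gr_near (gr_term mu Nk (algZ a hc)).
  by apply: nearW => t; rewrite mulrCA.
- by apply: gr_near (grD hu hv); apply: nearW => t; rewrite mulrDr.
- apply: gr_ext hu => b; rewrite -[b]add0r.
  apply: bigO_near (bigO_iterlnM (bigO_cst m a (lexx 0)) (uv b)).
  by apply: nearW => t; rewrite mulrBr.
Qed.

Lemma grN (R : realType) (m : nat) (mu : nat -> R) (ns : nat -> nat) (N : nat)
    (u : R -> R) : gr m mu ns N u -> gr m mu ns N (fun t => - u t).
Proof. by move=> /(grZ (-1)); apply: gr_near; apply: nearW => t; rewrite mulN1r. Qed.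

Lemma gr_sum (R : realType) (m : nat) (mu : nat -> R) (ns : nat -> nat) (N : nat)
    (I : Type) (s : seq I) (u : I -> R -> R) :
  (forall i, gr m mu ns N (u i)) -> gr m mu ns N (fun t => \sum_(i <- s) u i t).
Proof.
move=> hu; rewrite !unlock; elim: s => [|i s IH] /=; first exact: gr0.
exact: grD.
Qed.

Lemma gr_sum_nat (R : realType) (m : nat) (mu : nat -> R) (ns : nat -> nat)
    (N a b : nat) (u : nat -> R -> R) :
  (forall i, (a <= i)%N -> gr m mu ns N (u i)) ->
  gr m mu ns N (fun t => \sum_(a <= i < b) u i t).
Proof.
move=> hu; apply: gr_near (gr_sum (u := fun i => u (a + i)%N) (iota 0 (b - a)) _).
  apply: nearW => t.
  rewrite [RHS](_ : _ = \sum_(0 + a <= i < b) u i t)// big_addn /index_iota subn0.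
  by apply: eq_bigr => i _; rewrite addnC.
by move=> i; apply: hu; exact: leq_addr.
Qed.

(** The inequality on [a] is strict because the gap [mu k + a] has to absorb the growth of the
    coefficient. *)
Lemma gr_bound (R : realType) (m : nat) (mu : nat -> R) (ns : nat -> nat) (N : nat)
    (u : R -> R) (a : R) : expansion_scale m mu ns -> gr m mu ns N u -> - mu N < a ->
  bigO u (fun t => iterln m t `^ a).
Proof.
move=> S hu; elim: hu a => [k c Nk hc|{}u v _ hu _ hv|{}u v uv _ hu] a Na.
- have Nk' : mu N <= mu k by rewrite (scale_mono S).
  have e0 : 0 < mu k + a by lra.
  rewrite (_ : a = - mu k + (mu k + a)); last ring.
  apply: bigO_iterlnM; last exact: (alg_growth hc e0).
  by exists 1 => //; apply: nearW => t; rewrite mul1r ger0_norm ?powR_ge0.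
- by apply: bigOD; [exact: hu|exact: hv].
- apply: bigO_near (bigOD (hu a Na) (bigON (uv a))).
  by apply: nearW => t; rewrite opprB addrC subrK.
Qed.

(** As exponents are positive, the index s with mu_s = mu_k + mu_l exceeds both k and l. Gaining one
    rank per extra factor is crude, but spares all bookkeeping of which sums produce which mu_s. *)
Lemma gr_mul (R : realType) (m : nat) (mu : nat -> R) (ns : nat -> nat) (N N' : nat)
    (u v : R -> R) : expansion_scale m mu ns ->
  gr m mu ns N u -> gr m mu ns N' v -> gr m mu ns N.+1 (fun t => u t * v t).
Proof.
move=> S hu; have mu0 := scale_gt0 S.
have muN0 k : - mu k < 0 by rewrite oppr_lt0.
elim: hu v => [k c Nk hc|{}u u' _ hu _ hu'|{}u u' uu' hu0 hu] v hv.
- elim: hv => [l d Nl hd|{}v v' _ hv _ hv'|{}v v' vv' hv0 hv].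
  + have [s es] := scale_add S k l.
    have ks : (k < s)%N.
      by rewrite ltnNge -(scale_mono S) es -ltNge ltrDl.
    have ls : (l < s)%N.
      by rewrite ltnNge -(scale_mono S) es -ltNge ltrDr.
    have hcd : alg 0 m (ns s) (fun t => c t * d t).
      by apply: algM; [apply: alg_weaken hc|apply: alg_weaken hd] => //;
        apply: (scale_ns S); exact: ltnW.
    apply: gr_near (gr_term mu (leq_ltn_trans Nk ks) hcd).
    near=> t; rewrite mulrACA es opprD powRD//; apply/implyP => _.
    by rewrite gt_eqF//; near: t; exact: iterln_gt0.
  + by apply: gr_near (grD hv hv'); apply: nearW => t; rewrite mulrDr.
  + apply: gr_ext hv => a; rewrite -[a]add0r.
    apply: bigO_near (bigO_iterlnM (gr_bound S (gr_term mu Nk hc) (muN0 N)) (vv' a)).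
    by apply: nearW => t; rewrite mulrBr.
- by apply: gr_near (grD (hu v hv) (hu' v hv)); apply: nearW => t; rewrite mulrDl.
- apply: gr_ext (hu v hv) => a; rewrite -[a]addr0.
  apply: bigO_near (bigO_iterlnM (uu' a) (gr_bound S hv (muN0 N'))).
  by apply: nearW => t; rewrite mulrBl.
Unshelve. all: by end_near. Qed.

Lemma gr_lead (R : realType) (m : nat) (mu : nat -> R) (ns : nat -> nat) (N : nat)
    (u : R -> R) : gr m mu ns N u -> exists2 c, alg 0 m (ns N) c &
  gr m mu ns N.+1 (fun t => u t - iterln m t `^ (- mu N) * c t).
Proof.
elim=> [k c Nk hc|{}u v _ [c hc hu] _ [d hd hv]|{}u v uv _ [c hc hu]].
- have [Nk'|kN] := ltnP N k.
    exists (fun=> 0); first exact: alg_cst.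
    apply: gr_near (gr_term mu Nk' hc).
    by apply: nearW => t; rewrite mulr0 subr0.
  have eNk : N = k by apply/eqP; rewrite eqn_leq Nk.
  rewrite eNk; exists c => //; apply: gr_near (gr0 _ _ _ _).
  by apply: nearW => t; rewrite subrr.
- exists (fun t => c t + d t); first exact: algD.
  apply: gr_near (grD hu hv); apply: nearW => t; ring.
- exists c => //; apply: gr_ext hu => a; apply: bigO_near (uv a).
  by apply: nearW => t; ring.
Qed.

Lemma gr_div (R : realType) (m : nat) (mu : nat -> R) (ns : nat -> nat) (N : nat)
    (c : R -> R) : expansion_scale m mu ns -> alg 0 0 (ns N) c ->
  gr m mu ns N.+1 (fun t => iterln m t `^ (- mu N) * (c t / t)).
Proof.
move=> S hc; have [m0|m0] := posnP m; last first.
  apply: gr_negligible => a.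
  have : alg 0 0 (ns N) (fun t => iterln m t `^ (- mu N) * c t).
    by apply: algM => //; apply: alg_pow => //; exact: (scale_ns_ge S).
  move=> /(alg_div_negligible a m0); apply: bigO_near.
  by apply: nearW => t; rewrite mulrA.
have [s es] := scale_add1 S m0 N.
have Ns : (N < s)%N by rewrite ltnNge -(scale_mono S) es -ltNge ltrDl.
have hc' : alg 0 m (ns s) c.
  by apply: (alg_weaken _ _ _ hc); rewrite ?m0//; apply: (scale_ns S); exact: ltnW.
apply: gr_near (gr_term mu Ns hc').
near=> t; have t0 : 0 < t by near: t; exact: (iterln_gt0 R 0).
rewrite es opprD powRD; last by apply/implyP => _; rewrite m0 gt_eqF.
by rewrite m0 /iterln /= powR_inv1 ?ltW//; ring.
Unshelve. all: by end_near. Qed.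

Lemma hder_iterln_pow (R : realType) (m : nat) (a : R) : exists2 c : R -> R,
  alg 0 0 m c & \forall t \near +oo,
    has_deriv (fun x => iterln m x `^ a) t (iterln m t `^ a * (c t / t)).
Proof.
have powS (x : R) : 0 < x -> x `^ (a - 1) = x `^ a / x.
  move=> x0; rewrite powRD ?powR_inv1 ?(ltW x0)//.
  by apply/implyP => _; rewrite gt_eqF.
case: m => [|m].
  exists (fun=> a); first exact: alg_cst.
  near=> t; have t0 : 0 < t by near: t; exact: (iterln_gt0 R 0).
  apply: hder_eq (is_derive1_powR a t0) _.
  by rewrite powS//; rewrite /iterln /=; ring.
have [c [hc dc]] := hder_iterln R 0 m.
exists (fun t => a * (iterln m.+1 t `^ (-1) * c t)).
  by apply: algZ; apply: algM; [exact: alg_pow|exact: alg_weaken hc].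
near=> t; have t0 : 0 < iterln m.+1 t by near: t; exact: iterln_gt0.
have dct : has_deriv (fun x => iterln m.+1 x) t (c t / t) by near: t.
apply: hder_eq (hder_comp (is_derive1_powR a t0) dct) _.
by rewrite powS// powR_inv1 ?ltW//; ring.
Unshelve. all: by end_near. Qed.

(** Since c = O(t^(1/2)), c/t tends to 0. This makes powers of L_m decay subexponentially, as the
    stability estimate requires. *)
Lemma alg_div_small (R : realType) (k : nat) (c : R -> R) (e : R) :
  alg 0 0 k c -> 0 < e -> \forall t \near +oo, `|c t / t| <= e.
Proof.
move=> hc e0; have h2 : 0 < 2^-1 :> R by rewrite invr_gt0.
have [C C0 hC] := alg_growth hc h2; near=> t.
have t0 : 0 < t by near: t; exact: (iterln_gt0 R 0).
have t1 : (C / e) ^+ 2 <= t by near: t; exact: (iterln_ge 0).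
rewrite normrM normrV ?unitfE ?gt_eqF// (gtr0_norm t0) ler_pdivrMr//.
have : `|c t| <= C * iterln 0 t `^ 2^-1 by near: t.
move/le_trans; apply; rewrite -[iterln 0 t]/t powR12_sqrt ?(ltW t0)//.
have Ce : C / e <= Num.sqrt t.
  have Ce0 : 0 <= C / e by rewrite divr_ge0// ltW.
  by rewrite -(ger0_norm Ce0) -sqrtr_sqr ler_sqrt.
have : C <= e * Num.sqrt t by rewrite mulrC -ler_pdivrMr.
have := sqr_sqrtr (ltW t0); have := sqrtr_ge0 t.
by move: (Num.sqrt t) => s s0 es h; rewrite -es expr2 mulrA ler_wpM2r.
Unshelve. all: by end_near. Qed.

(** Homogeneous polynomials of degree [d], built by one variable at a time so that estimates go by
    induction; zero has every degree. *)
Inductive hpoly (R : realType) (n : nat) : nat -> ('cV[R]_n -> R) -> Prop :=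
| hpoly_cst c : hpoly 0 (fun=> c)
| hpoly_var d i f : hpoly d f -> hpoly d.+1 (fun x => x i 0 * f x)
| hpoly0 d : hpoly d (fun=> 0)
| hpolyD d f g : hpoly d f -> hpoly d g -> hpoly d (fun x => f x + g x).

Lemma hpoly_pow (R : realType) (n d e : nat) (i : 'I_n) (f : 'cV[R]_n -> R) :
  hpoly d f -> hpoly (e + d) (fun x => x i 0 ^+ e * f x).
Proof.
elim: e => [|e IH] hf.
  by rewrite (_ : (fun x => _) = f)//; apply/funext => x; rewrite mul1r.
rewrite (_ : (fun x => _) = fun x : 'cV[R]_n => x i 0 * (x i 0 ^+ e * f x)).
  by rewrite addSn; apply: hpoly_var; exact: IH.
by apply/funext => x; rewrite exprS mulrA.
Qed.

Lemma hpoly_sum (R : realType) (n d : nat) (I : eqType) (s : seq I)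
    (f : I -> 'cV[R]_n -> R) : (forall i, i \in s -> hpoly d (f i)) ->
  hpoly d (fun x => \sum_(i <- s) f i x).
Proof.
rewrite !unlock; elim: s => [|i s IH] hf /=; first exact: hpoly0.
apply: hpolyD; first by apply: hf; rewrite mem_head.
by apply: IH => j js; apply: hf; rewrite in_cons js orbT.
Qed.

Lemma hpoly_homog (R : realType) (n d : nat) (F : 'cV[R]_n -> 'cV[R]_n) (i : 'I_n) :
  homogeneous_poly_map d F -> hpoly d (fun x => F x i 0).
Proof.
move=> [P [hP hF]]; rewrite (_ : (fun x => _) =
  fun x : 'cV[R]_n => \sum_(M <- mpoly.msupp (P i))
    mpoly.mcoeff M (P i) * \prod_(j < n) x j 0 ^+ (M j)); last first.
  by apply/funext => x; rewrite hF mpoly.mevalE.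
apply: hpoly_sum => M /(mpoly.dhomog_mf (hP i)) <-.
rewrite [X in hpoly X](_ : _ = (\sum_j M j)%N); last exact: mpoly.mdegE.
set c := mpoly.mcoeff _ _.
rewrite !unlock; elim: (index_enum _) => [|j s IH] /=.
  exact: hpoly_cst.
rewrite (_ : (fun x => _) = fun x : 'cV[R]_n => x j 0 ^+ (M j) * (c * foldr
   (fun i x0 => x i 0 ^+ (M i) * x0) 1 s)); first exact: hpoly_pow.
by apply/funext => x; rewrite mulrCA.
Qed.

Definition grv (R : realType) (m : nat) (mu : nat -> R) (ns : nat -> nat) (n N : nat)
    (g : R -> 'cV[R]_n) : Prop := forall i, gr m mu ns N (fun t => g t i 0).

Lemma grvD (R : realType) (m : nat) (mu : nat -> R) (ns : nat -> nat) (n N : nat)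
    (a b : R -> 'cV[R]_n) :
  grv m mu ns N a -> grv m mu ns N b -> grv m mu ns N (fun t => a t + b t).
Proof.
move=> ha hb i; apply: gr_near (grD (ha i) (hb i)).
by apply: nearW => t; rewrite mxE.
Qed.

Lemma grv_weaken (R : realType) (m : nat) (mu : nat -> R) (ns : nat -> nat)
    (n N N' : nat) (a : R -> 'cV[R]_n) : (N' <= N)%N ->
  grv m mu ns N a -> grv m mu ns N' a.
Proof. by move=> NN ha i; exact: gr_weaken (ha i). Qed.

(** The factor [u] accumulates the variables peeled off so far, each raising the rank by one. *)
Lemma hpoly_gr_mul (R : realType) (m : nat) (mu : nat -> R) (ns : nat -> nat)
    (n d N : nat) (f : 'cV[R]_n -> R) (a : R -> 'cV[R]_n) (u : R -> R) :
  expansion_scale m mu ns -> hpoly d f -> grv m mu ns 0 a -> gr m mu ns N u ->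
  gr m mu ns (N + d) (fun t => u t * f (a t)).
Proof.
move=> S hf ha; elim: hf N u => [c|{}d i {}f _ IH|{}d|{}d {}f g _ hf _ hg] N u hu.
- rewrite addn0; apply: gr_near (grZ c hu).
  by apply: nearW => t; rewrite mulrC.
- rewrite addnS -addSn; apply: gr_near (IH _ _ (gr_mul S hu (ha i))).
  by apply: nearW => t; rewrite mulrA.
- by apply: gr_near (gr0 _ _ _ _); apply: nearW => t; rewrite mulr0.
- apply: gr_near (grD (hf _ _ hu) (hg _ _ hu)).
  by apply: nearW => t; rewrite mulrDr.
Qed.

Lemma hpoly_gr (R : realType) (m : nat) (mu : nat -> R) (ns : nat -> nat)
    (n d : nat) (f : 'cV[R]_n -> R) (a : R -> 'cV[R]_n) :
  expansion_scale m mu ns -> hpoly d f -> grv m mu ns 0 a -> (0 < d)%N ->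
  gr m mu ns d.-1 (fun t => f (a t)).
Proof.
move=> S hf ha; elim: hf => [c|{}d i {}f hf _|{}d|{}d {}f g _ hf _ hg] d0 //=.
- by rewrite -[d]add0n; exact: hpoly_gr_mul.
- exact: gr0.
- by apply: grD; [exact: hf|exact: hg].
Qed.

(** Telescoping: (a_i + b_i) f(a+b) - a_i f(a) = a_i (f(a+b) - f(a)) + b_i f(a+b). Each resulting
    term contains a factor from [b], of rank [N], and the further factor [u] lifts it to [N.+1]. *)
Lemma hpoly_gr_mul_diff (R : realType) (m : nat) (mu : nat -> R) (ns : nat -> nat)
    (n d N : nat) (f : 'cV[R]_n -> R) (a b : R -> 'cV[R]_n) (u : R -> R) :
  expansion_scale m mu ns -> hpoly d f -> grv m mu ns 0 a -> grv m mu ns N b ->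
  gr m mu ns 0 u -> gr m mu ns N.+1 (fun t => u t * (f (a t + b t) - f (a t))).
Proof.
move=> S hf ha hb; have hab := grvD ha (grv_weaken (leq0n N) hb).
elim: hf u => [c|{}d i {}f hf IH|{}d|{}d {}f g _ hf _ hg] u hu.
- by apply: gr_near (gr0 _ _ _ _); apply: nearW => t; rewrite subrr mulr0.
- have h1 := IH _ (gr_weaken (leq0n 1) (gr_mul S hu (ha i))).
  have h2 := gr_weaken (leq_addr d N.+1) (hpoly_gr_mul S hf hab (gr_mul S (hb i) hu)).
  by apply: gr_near (grD h1 h2); apply: nearW => t; rewrite mxE; ring.
- by apply: gr_near (gr0 _ _ _ _); apply: nearW => t; rewrite subrr mulr0.
- by apply: gr_near (grD (hf _ hu) (hg _ hu)); apply: nearW => t; ring.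
Qed.

Lemma hpoly_gr_diff (R : realType) (m : nat) (mu : nat -> R) (ns : nat -> nat)
    (n d N : nat) (f : 'cV[R]_n -> R) (a b : R -> 'cV[R]_n) :
  expansion_scale m mu ns -> hpoly d f -> grv m mu ns 0 a -> grv m mu ns N b ->
  (1 < d)%N -> gr m mu ns N.+1 (fun t => f (a t + b t) - f (a t)).
Proof.
move=> S hf ha hb; have hab := grvD ha (grv_weaken (leq0n N) hb).
elim: hf => [c|{}d i {}f hf _|{}d|{}d {}f g _ IHf _ IHg] d1 //.
- have h1 := hpoly_gr_mul_diff S hf ha hb (ha i).
  have h2 : gr m mu ns N.+1 (fun t => b t i 0 * f (a t + b t)).
    by apply: gr_weaken (hpoly_gr_mul S hf hab (hb i)); rewrite -addn1 leq_add2l.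
  by apply: gr_near (grD h1 h2); apply: nearW => t; rewrite mxE; ring.
- by apply: gr_near (gr0 _ _ _ _); apply: nearW => t; rewrite subrr.
- by apply: gr_near (grD (IHf d1) (IHg d1)); apply: nearW => t; ring.
Qed.

(* [d.-1] is truncated: constants have zero differences anyway. *)
Lemma hpoly_lipschitz (R : realType) (n d : nat) (f : 'cV[R]_n -> R) : hpoly d f ->
  exists2 C, 0 < C & forall (rho delta : R) (x y : 'cV[R]_n), 0 <= rho -> rho <= 1 ->
    (forall i, `|x i 0| <= rho) -> (forall i, `|y i 0| <= rho) ->
    (forall i, `|x i 0 - y i 0| <= delta) ->
  `|f y| <= C * rho ^+ d /\ (0 <= delta -> `|f x - f y| <= C * rho ^+ d.-1 * delta).
Proof.
elim=> [c|{}d i {}f _ [C C0 hC]|{}d|{}d {}f g _ [C C0 hC] _ [D D0 hD]].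
- exists (1 + `|c|); first by rewrite ltr_pwDl.
  move=> rho delta x y r0 r1 hx hy hxy; rewrite subrr normr0 expr0 !mulr1.
  by split=> [|d0]; rewrite ?lerDr// mulr_ge0// addr_ge0.
- exists (C + C); first by rewrite addr_gt0.
  move=> rho delta x y r0 r1 hx hy hxy; have [hf hd] := hC _ _ _ _ r0 r1 hx hy hxy.
  have rd0 : 0 <= rho ^+ d by rewrite exprn_ge0.
  have hyf : `|y i 0 * f y| <= rho * (C * rho ^+ d) by rewrite normrM ler_pM.
  split.
    apply: le_trans hyf _; rewrite exprS.
    by rewrite mulrCA ler_wpM2r ?mulr_ge0//; lra.
  move=> d0; rewrite /= (_ : _ - _ = x i 0 * (f x - f y) + (x i 0 - y i 0) * f y);
    last by ring.
  apply: le_trans (ler_normD _ _) _.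
  rewrite [leRHS](_ : _ = C * rho ^+ d * delta + C * rho ^+ d * delta); last by ring.
  apply: lerD; rewrite normrM.
    have : `|x i 0| * `|f x - f y| <= rho * (C * rho ^+ d.-1 * delta).
      by apply: ler_pM => //; exact: hd.
    move/le_trans; apply.
    have : rho * rho ^+ d.-1 <= rho ^+ d by case: (d) => [|d'] /=; rewrite ?expr0 ?mulr1 -?exprS.
    have : 0 <= C * delta by rewrite mulr_ge0// ltW.
    by move: (rho ^+ d.-1) (rho ^+ d) => p q h0 h1; nra.
  have : `|x i 0 - y i 0| * `|f y| <= delta * (C * rho ^+ d) by apply: ler_pM.
  by rewrite [delta * _]mulrC.
- exists 1 => // rho delta x y r0 r1 hx hy hxy; rewrite subrr normr0.
  by split=> [|d0]; rewrite ?mulr_ge0// exprn_ge0.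
- exists (C + D); first by rewrite addr_gt0.
  move=> rho delta x y r0 r1 hx hy hxy.
  have [hf hfd] := hC _ _ _ _ r0 r1 hx hy hxy.
  have [hg hgd] := hD _ _ _ _ r0 r1 hx hy hxy.
  rewrite !mulrDl; split=> [|d0].
    by apply: le_trans (ler_normD _ _) _; rewrite lerD.
  rewrite opprD addrACA; apply: le_trans (ler_normD _ _) _.
  by rewrite lerD ?hfd ?hgd.
Qed.

(** * Formal expansion *)

(** The defect of [Y] in the equation, with [f] cut after index [N] and G after degree N+2. Omitted
    degrees would have rank above [N] at [Y], and the quadratic part is kept even for [N = 0]. *)
Definition residual (R : realType) (n : nat) (A : 'M[R]_n)
    (Gm : nat -> 'cV[R]_n -> 'cV[R]_n) (m : nat) (mu : nat -> R)
    (p : nat -> R -> 'cV[R]_n) (N : nat) (Y dY : R -> 'cV[R]_n) (t : R) : 'cV[R]_n :=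
  - dY t - A *m Y t + \sum_(2 <= j < N.+3) Gm j (Y t)
  + \sum_(k < N.+1) iterln m t `^ (- mu k) *: p k t.

Definition approx (R : realType) (n : nat) (A : 'M[R]_n)
    (Gm : nat -> 'cV[R]_n -> 'cV[R]_n) (m : nat) (mu : nat -> R) (ns : nat -> nat)
    (p : nat -> R -> 'cV[R]_n) (N : nat) (Y : R -> 'cV[R]_n) : Prop :=
  grv m mu ns 0 Y /\ exists dY : R -> 'cV[R]_n,
    (\forall t \near +oo, forall i, has_deriv (fun x => Y x i 0) t (dY t i 0)) /\
    grv m mu ns N (residual A Gm m mu p N Y dY).

Lemma approx0 (R : realType) (n : nat) (A : 'M[R]_n)
    (Gm : nat -> 'cV[R]_n -> 'cV[R]_n) (m : nat) (mu : nat -> R) (ns : nat -> nat)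
    (p : nat -> R -> 'cV[R]_n) : expansion_scale m mu ns ->
  (forall j, (1 < j)%N -> forall i, hpoly j (fun x => Gm j x i 0)) ->
  (forall k, algv 0 m (ns k) (p k)) ->
  approx A Gm m mu ns p 0 (fun=> 0).
Proof.
move=> S hG hp.
have h0 : grv m mu ns 0 (fun=> 0 : 'cV[R]_n).
  by move=> i; apply: gr_near (gr0 _ _ _ _); apply: nearW => t; rewrite mxE.
split=> //; exists (fun=> 0); split.
  by apply: nearW => t i; rewrite mxE; exact: hder_cst.
move=> i; have h2 := hpoly_gr S (hG 2 isT i) h0 isT.
apply: gr_near (grD (gr_weaken (leq0n 1) h2) (gr_term mu (leqnn 0) (hp 0%N i))).
apply: nearW => t; rewrite /residual oppr0 add0r mulmx0 oppr0 add0r.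
by rewrite big_nat1 big_ord_recl big_ord0 addr0 !mxE.
Qed.

(** The new term cancels the leading part of the residual: q' + A q = c up to 1/t. It perturbs the
    nonlinear part only at rank [N.+1], since that part is at least quadratic. *)
Lemma approx_step (R : realType) (n : nat) (A : 'M[R]_n)
    (Gm : nat -> 'cV[R]_n -> 'cV[R]_n) (m : nat) (mu : nat -> R) (ns : nat -> nat)
    (p : nat -> R -> 'cV[R]_n) (N : nat) (Y : R -> 'cV[R]_n) :
  eigenvalues_pos_real_part A -> expansion_scale m mu ns ->
  (forall j, (1 < j)%N -> forall i, hpoly j (fun x => Gm j x i 0)) ->
  (forall k, algv 0 m (ns k) (p k)) ->
  approx A Gm m mu ns p N Y ->
  exists q : R -> 'cV[R]_n, algv 0 m (ns N) q /\
    approx A Gm m mu ns p N.+1 (fun t => Y t + iterln m t `^ (- mu N) *: q t).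
Proof.
move=> hA S hG hp [hY [dY [hdY hres]]].
have /choice[c0 hc0] : forall i, exists c, alg 0 m (ns N) c /\
    gr m mu ns N.+1 (fun t => residual A Gm m mu p N Y dY t i 0
      - iterln m t `^ (- mu N) * c t).
  by move=> i; have [c hc h] := gr_lead (hres i); exists c.
pose c t : 'cV[R]_n := \col_i c0 i t.
have cE t i : c t i 0 = c0 i t by rewrite mxE.
have hc : algv 0 m (ns N) c.
  by move=> i; rewrite (_ : (fun t => _) = c0 i); [exact: (hc0 i).1|apply/funext => t].
have [q [r [hq hr dq]]] := algv_solve hA hc.
have [rho hrho drho] := hder_iterln_pow m (- mu N).
have {}hrho : alg 0 0 (ns N) rho.
  by apply: alg_weaken hrho => //; exact: (scale_ns_ge S).
pose b t := iterln m t `^ (- mu N) *: q t.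
have hb : grv m mu ns N b.
  move=> i; apply: gr_near (gr_term mu (leqnn N) (hq i)).
  by apply: nearW => t; rewrite [RHS]mxE.
exists q; split=> //; split; first exact: grvD hY (grv_weaken (leq0n N) hb).
pose db t := (iterln m t `^ (- mu N) * (rho t / t)) *: q t +
  iterln m t `^ (- mu N) *: (- (A *m q t) + c t + t^-1 *: r t).
exists (fun t => dY t + db t); split.
  near=> t => i.
  have h1 : forall i, has_deriv (fun x => Y x i 0) t (dY t i 0) by near: t.
  have h2 : forall i, has_deriv (fun x => q x i 0) t
     ((- (A *m q t) + c t) i 0 + r t i 0 / t) by near: t.
  have h3 : has_deriv (fun x => iterln m x `^ (- mu N)) t
     (iterln m t `^ (- mu N) * (rho t / t)) by near: t.
  rewrite (_ : (fun x => _) = fun x => Y x i 0 + iterln m x `^ (- mu N) * q x i 0).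
    apply: hder_eq (hderD (h1 i) (hderM h3 (h2 i))) _.
    by rewrite /db; move: (A *m q t) => Aq; rewrite !mxE; ring.
  by apply/funext => x; rewrite [LHS]mxE [X in _ + X]mxE.
move=> i.
(* The new residual consists of: the old one without its leading term ([e1]), the 1/t error of [q]
   ([e2]), the derivative of the power of L_m ([e3]), the change of the Taylor polynomial ([e4]),
   the new degree N+3 ([e5]) and the new term of [f] ([e6]). *)
have e1 := (hc0 i).2.
have e2 := grN (gr_div S (hr i)).
have hrq : alg 0 0 (ns N) (fun t => rho t * q t i 0).
  by apply: algM => //; apply: alg_weaken (hq i).
have e3 := grN (gr_div S hrq).
have e4 : gr m mu ns N.+1 (fun t => \sum_(2 <= j < N.+4)
    (Gm j (Y t + b t) i 0 - Gm j (Y t) i 0)).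
  by apply: gr_sum_nat => j j2; apply: hpoly_gr_diff (hG j j2 i) hY hb j2.
have e5 := gr_weaken (leqnSn N.+1) (hpoly_gr S (hG N.+3 isT i) hY isT).
have e6 := gr_term mu (leqnn N.+1) (hp N.+1 i).
apply: gr_near (grD (grD (grD e1 e2) (grD e3 e4)) (grD e5 e6)).
apply: nearW => t; rewrite /residual /= -/(b t).
have eG : \sum_(2 <= j < N.+4) Gm j (Y t) i 0 =
    \sum_(2 <= j < N.+3) Gm j (Y t) i 0 + Gm N.+3 (Y t) i 0.
  by rewrite big_nat_recr.
rewrite sumrB eG [in RHS]big_ord_recr /=.
have Ab : A *m b t = iterln m t `^ (- mu N) *: (A *m q t) by rewrite -scalemxAr.
rewrite mulmxDr Ab /db -!cE.
set E := _ `^ (- mu N); set E' := _ `^ (- mu N.+1).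
set SP := \sum_(k < N.+1) _.
move: (A *m q t) (A *m Y t) SP => Aq AY SP.
rewrite !mxE !summxE; ring.
Unshelve. all: by end_near. Qed.

(** One sequence has to serve all [N], so a step function is chosen once on pairs (N, Y) and then
    iterated from Y = 0. *)
Lemma approx_sequence (R : realType) (n : nat) (A : 'M[R]_n)
    (Gm : nat -> 'cV[R]_n -> 'cV[R]_n) (m : nat) (mu : nat -> R) (ns : nat -> nat)
    (p : nat -> R -> 'cV[R]_n) :
  eigenvalues_pos_real_part A -> expansion_scale m mu ns ->
  (forall j, (1 < j)%N -> forall i, hpoly j (fun x => Gm j x i 0)) ->
  (forall k, algv 0 m (ns k) (p k)) ->
  exists q : nat -> R -> 'cV[R]_n, (forall k, algv 0 m (ns k) (q k)) /\
    forall N, approx A Gm m mu ns p N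
      (fun t => \sum_(k < N) iterln m t `^ (- mu k) *: q k t).
Proof.
move=> hA S hG hp.
have /choice[Q hQ] : forall x : nat * (R -> 'cV[R]_n), exists q : R -> 'cV[R]_n,
    approx A Gm m mu ns p x.1 x.2 -> algv 0 m (ns x.1) q /\
    approx A Gm m mu ns p x.1.+1 (fun t => x.2 t + iterln m t `^ (- mu x.1) *: q t).
  (* The step function is total; on pairs that are not approximations it takes the value 0. *)
  move=> [N Y]; have [h|h] := pselect (approx A Gm m mu ns p N Y).
    by have [q hq] := approx_step hA S hG hp h; exists q.
  by exists (fun=> 0).
pose Y := fix Y N : R -> 'cV[R]_n := if N is M.+1
  then (fun t => Y M t + iterln m t `^ (- mu M) *: Q (M, Y M) t) else fun=> 0.
have hY N : approx A Gm m mu ns p N (Y N).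
  elim: N => [|N IH]; first exact: approx0.
  by have [_] := hQ (N, Y N) IH.
exists (fun k => Q (k, Y k)); split=> [k|N]; first by have [] := hQ (k, Y k) (hY k).
rewrite (_ : (fun t => _) = Y N)//; apply/funext => t.
elim: N => [|N IH]; first by rewrite big_ord0.
by rewrite big_ord_recr /= IH.
Qed.

(** * Comparison of norms, and stability at the scale of powers of L_m *)

Definition norm1 (R : realType) (n : nat) (x : 'cV[R]_n) : R := \sum_i `|x i 0|.

Lemma norm1_ge0 (R : realType) (n : nat) (x : 'cV[R]_n) : 0 <= norm1 x.
Proof. by apply: sumr_ge0. Qed.

Lemma le_norm1 (R : realType) (n : nat) (x : 'cV[R]_n) i : `|x i 0| <= norm1 x.
Proof. by rewrite /norm1 (bigD1 i)//= lerDl sumr_ge0. Qed.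

Lemma norm1_sqr (R : realType) (n : nat) (x : 'cV[R]_n) :
  norm1 x ^+ 2 <= n%:R * sq x.
Proof.
apply: le_trans (sqr_sum_le _) _; rewrite ler_wpM2l//.
by apply: ler_sum => i _; rewrite -normrX ger0_norm ?sqr_ge0// expr2.
Qed.

Lemma enormE (R : realType) (n : nat) (x : 'cV[R]_n) : enorm x = Num.sqrt (sq x).
Proof. by congr Num.sqrt; apply: eq_bigr => i _; rewrite expr2. Qed.

Lemma sqr_le_sq (R : realType) (n : nat) (x : 'cV[R]_n) i : x i 0 ^+ 2 <= sq x.
Proof.
rewrite /sq /dot (bigD1 i)//= -expr2 lerDl sumr_ge0// => j _.
by rewrite -expr2 sqr_ge0.
Qed.

Lemma le_enorm (R : realType) (n : nat) (x : 'cV[R]_n) i : `|x i 0| <= enorm x.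
Proof. by rewrite -sqrtr_sqr enormE ler_sqrt ?sq_ge0// sqr_le_sq. Qed.

Lemma enorm_le_norm1 (R : realType) (n : nat) (x : 'cV[R]_n) : enorm x <= norm1 x.
Proof.
rewrite -[leRHS]ger0_norm ?norm1_ge0// -sqrtr_sqr enormE ler_sqrt ?sqr_ge0//.
rewrite expr2 {1}/norm1 mulr_suml; apply: ler_sum => i _; rewrite -expr2.
by rewrite -real_normK ?num_real// expr2 ler_wpM2l// le_norm1.
Qed.

Lemma bigO_small (R : realType) (m : nat) (u : R -> R) (a e : R) : 0 < a -> 0 < e ->
  bigO u (fun t => iterln m t `^ (- a)) -> \forall t \near +oo, `|u t| <= e.
Proof.
move=> a0 e0 [C C0 hu]; near=> t.
have L0 : 0 < iterln m t by near: t; exact: iterln_gt0.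
have L1 : (C / e) `^ a^-1 <= iterln m t by near: t; exact: iterln_ge.
have : `|u t| <= C * iterln m t `^ (- a) by near: t.
move/le_trans; apply; rewrite powRN ler_pdivrMr ?powR_gt0//.
have Ce : 0 < C / e by rewrite divr_gt0.
rewrite mulrC -ler_pdivrMr// -[leLHS](powRr1 (ltW Ce)) -(mulVf (lt0r_neq0 a0)).
by rewrite powRrM ge0_ler_powR ?nnegrE ?powR_ge0 ?(ltW a0) ?(ltW L0).
Unshelve. all: by end_near. Qed.

Lemma bigO_stability (R : realType) (n : nat) (A : 'M[R]_n) (m : nat) (nu : R)
    (w h1 h2 : R -> 'cV[R]_n) : (0 < n)%N -> eigenvalues_pos_real_part A ->
  (\forall t \near +oo, forall i,
    has_deriv (fun x => w x i 0) t ((- (A *m w t) + (h1 t + h2 t)) i 0)) ->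
  (forall eta, 0 < eta ->
    \forall t \near +oo, forall i, `|h1 t i 0| <= eta * norm1 (w t)) ->
  (forall i, bigO (fun t => h2 t i 0) (fun t => iterln m t `^ (- nu))) ->
  forall i, bigO (fun t => w t i 0) (fun t => iterln m t `^ (- nu)).
Proof.
move=> n0 hA hw hh1 hh2; have [e [e0 stab]] := linear_stability n0 hA.
have n0' : 0 < n%:R :> R by rewrite ltr0n.
(* One has |h1|^2 <= n^2 eta^2 |w|^2, and splitting |h1 + h2|^2 doubles it; the bound by 1 replaces
   eta^2 by eta. *)
pose eta := Num.min 1 (e / (2 * n%:R ^+ 2)).
have eta0 : 0 < eta by rewrite lt_min ltr01 divr_gt0// mulr_gt0// exprn_gt0.
have eta1 : eta <= 1 by rewrite ge_min lexx.
have etae : 2 * (n%:R ^+ 2 * eta ^+ 2) <= e.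
  have : eta <= e / (2 * n%:R ^+ 2) by rewrite ge_min lexx orbT.
  rewrite ler_pdivlMr ?mulr_gt0 ?exprn_gt0// => h.
  apply: le_trans h; have : 0 <= n%:R ^+ 2 :> R by rewrite sqr_ge0.
  by move: (n%:R ^+ 2) => s s0; have := mulr_ge0 s0 (ltW eta0); nra.
(* The stability estimate concerns squares, hence the doubled exponent; a square root is taken at
   the end. *)
pose psi t : R := iterln m t `^ (- nu + - nu).
have [K K0 hK] : bigO (fun t => sq (h2 t)) psi.
  apply: bigO_sum => [|i]; first by apply: nearW => t; rewrite powR_ge0.
  exact: bigO_iterlnM.
have [c hc dc] := hder_iterln_pow m (- nu + - nu).
have [C C0 hC] : exists2 C, 0 < C & \forall t \near +oo, sq (w t) <= C * psi t.
  apply: (stab w _ psi (fun t => psi t * (c t / t)) (2 * K) hw).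
  - near=> t.
    have h1t : forall i, `|h1 t i 0| <= eta * norm1 (w t).
      by near: t; exact: hh1.
    have h2t : sq (h2 t) <= K * psi t.
      by apply: le_trans (ler_norm _) _; near: t.
    apply: le_trans (sqD_le _ _) _; rewrite -mulrA lerD//; last by rewrite ler_pM2l.
    have : sq (h1 t) <= n%:R * (eta * norm1 (w t)) ^+ 2.
      rewrite /sq /dot -[n in n%:R]card_ord -sum1_card natr_sum mulr_suml.
      apply: ler_sum => i _; rewrite mul1r -expr2 -real_normK ?num_real//.
      by rewrite ler_sqr ?nnegrE ?mulr_ge0 ?norm1_ge0 ?(ltW eta0).
    have := norm1_sqr (w t); have := sq_ge0 (w t).
    move: (sq (w t)) (sq (h1 t)) (norm1 (w t)) => s s1 N1 s0 hN hs1.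
    apply: le_trans (_ : 2 * (n%:R ^+ 2 * eta ^+ 2) * s <= _); last by rewrite ler_wpM2r.
    rewrite -mulrA ler_pM2l//; apply: le_trans hs1 _; rewrite exprMn.
    rewrite [leRHS](_ : _ = n%:R * (eta ^+ 2 * (n%:R * s))); last by ring.
    by rewrite ler_pM2l// ler_wpM2l ?sqr_ge0.
  - near=> t; split; last by near: t.
    by apply: powR_gt0; near: t; exact: iterln_gt0.
  - move=> a a0; near=> t.
    have : `|c t / t| <= a by near: t; exact: alg_div_small hc a0.
    have : 0 <= psi t by exact: powR_ge0.
    rewrite ler_norml => p0 /andP[h _]; rewrite mulrC; exact: ler_wpM2l.
move=> i; exists (Num.sqrt C); first by rewrite sqrtr_gt0.
near=> t; have L0 : 0 < iterln m t by near: t; exact: iterln_gt0.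
rewrite -sqrtr_sqr -[X in _ * X]ger0_norm ?powR_ge0// -sqrtr_sqr -sqrtrM ?(ltW C0)//.
rewrite ler_sqrt; last by rewrite mulr_ge0 ?sqr_ge0 ?(ltW C0).
apply: le_trans (sqr_le_sq _ _) _.
rewrite expr2 -powRD; first by near: t.
by apply/implyP => _; rewrite gt_eqF.
Unshelve. all: by end_near. Qed.

(** * Error estimate *)

(** The numbers mu_0 < 2 mu_0 < ... < (k+1) mu_0 are k+1 elements of S, so the last one has index at
    least k. *)
Lemma scale_mul_ge (R : realType) (m : nat) (mu : nat -> R) (ns : nat -> nat) (k : nat) :
  expansion_scale m mu ns -> mu k <= k.+1%:R * mu 0%N.
Proof.
move=> S.
have [s ks <-] : exists2 s, (k <= s)%N & mu s = k.+1%:R * mu 0%N.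
  elim: k => [|k [s ks es]]; first by exists 0%N => //; rewrite mul1r.
  have [s' es'] := scale_add S s 0%N; exists s'.
    apply: leq_ltn_trans ks _.
    by rewrite ltnNge -(scale_mono S) es' -ltNge ltrDl (scale_gt0 S).
  by rewrite es' es -[k.+2]addn1 natrD mulrDl mul1r.
by rewrite (scale_mono S).
Qed.

Lemma taylor_norm1 (R : realType) (n : nat) (G : 'cV[R]_n -> 'cV[R]_n)
    (Gm : nat -> 'cV[R]_n -> 'cV[R]_n) (N : nat) :
  (exists delta : R, 0 < delta /\ exists r C : R, [/\ 0 < r, 0 < C &
    forall x : 'cV[R]_n, enorm x < r ->
      enorm (G x - \sum_(2 <= m < N.+1) Gm m x) <= C * enorm x `^ (N%:R + delta)]) ->
  exists r C : R, [/\ 0 < r, 0 < C & forall x, norm1 x <= r -> forall i,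
    `|(G x - \sum_(2 <= m < N.+1) Gm m x) i 0| <= C * norm1 x ^+ N].
Proof.
move=> [d [d0 [r [C [r0 C0 h]]]]].
exists (Num.min 1 (r / 2)), C; split=> //; first by rewrite lt_min ltr01 divr_gt0.
move=> x; rewrite le_min => /andP[x1 xr] i.
have er : enorm x < r by have := enorm_le_norm1 x; lra.
have e0 : 0 <= enorm x by rewrite sqrtr_ge0.
apply: le_trans (le_enorm _ _) _; apply: le_trans (h _ er) _; rewrite ler_pM2l//.
apply: le_trans (_ : enorm x ^+ N <= _); last first.
  by rewrite lerXn2r ?nnegrE ?norm1_ge0// enorm_le_norm1.
have [->|x0] := eqVneq (enorm x) 0.
  rewrite powR0 ?exprn_ge0// gt_eqF// ltr_wpDl//.
have e1 : enorm x <= 1 := le_trans (enorm_le_norm1 _) x1.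
rewrite -powR_mulrn// ger_powR ?lt0r ?x0 ?e0 ?e1// lerDl ltW//.
Qed.

Lemma cvg0_norm1 (R : realType) (n : nat) (y : R -> 'cV[R]_n) (e : R) :
  y t @[t --> +oo] --> (0 : 'cV[R]_n) -> 0 < e ->
  \forall t \near +oo, norm1 (y t) <= e.
Proof.
move=> cy e0; pose e1 := e / n.+1%:R.
have e10 : 0 < e1 by rewrite divr_gt0.
move/cvgr0Pnorm_lt : cy => /(_ e1 e10) cy; near=> t.
have ht : `|y t| < e1 by near: t.
apply: le_trans (_ : \sum_(i < n) e1 <= _).
  apply: ler_sum => i _; apply: le_trans (ltW ht).
  rewrite [leRHS]/Num.Def.normr/= mx_normrE.
  exact: (le_bigmax _ (fun ij : 'I_n * 'I_1 => `|y t ij.1 ij.2|) (i, 0)).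
rewrite sumr_const card_ord -mulr_natl /e1 mulrCA ler_piMr ?(ltW e0)//.
by rewrite ler_pdivrMr// mul1r ler_nat.
Unshelve. all: by end_near. Qed.

Lemma C1_solution_deriv (R : realType) (n : nat) (A : 'M[R]_n)
    (G : 'cV[R]_n -> 'cV[R]_n) (f : R -> 'cV[R]_n) (T0 : R) (y : R -> 'cV[R]_n) :
  C1_solution A G f T0 y -> \forall t \near +oo, forall i,
  has_deriv (fun x => y x i 0) t ((- (A *m y t) + G (y t) + f t) i 0).
Proof.
move=> [dy _ ey]; have : \forall t \near +oo, T0 < t.
  exact: (nbhs_pinfty_gt (num_real T0)).
apply: filterS => t Tt i; have d := dy t Tt.
rewrite -ey// derive1E derive_mx// mxE.
by apply: DeriveDef => //; exact: (derivable_mxP _ _ _).1.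
Qed.

Lemma O_infty_bigO (R : realType) (n : nat) (u : R -> 'cV[R]_n) (h : R -> R) i :
  O_infty u h -> bigO (fun t => u t i 0) h.
Proof.
move=> [T [C [T0 C0 hu]]]; exists C => //; apply/near_pinftyP; exists T => // t Tt.
exact: le_trans (le_enorm _ _) (hu t Tt).
Qed.

Lemma bigO_norm1 (R : realType) (n : nat) (u : R -> 'cV[R]_n) (h : R -> R) :
  (\forall t \near +oo, 0 <= h t) -> (forall i, bigO (fun t => u t i 0) h) ->
  bigO (fun t => norm1 (u t)) h.
Proof.
move=> h0 hu; apply: bigO_sum => // i; have [C C0 hC] := hu i; exists C => //.
by apply: filterS hC => t; rewrite normr_id.
Qed.

Lemma bigO_O_infty (R : realType) (n : nat) (u : R -> 'cV[R]_n) (h : R -> R) :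
  (\forall t \near +oo, 0 <= h t) -> (forall i, bigO (fun t => u t i 0) h) ->
  O_infty u h.
Proof.
move=> h0 hu; have [C C0 /near_pinftyP[T T0 hT]] := bigO_norm1 h0 hu.
exists T, C; split=> // t Tt; apply: le_trans (enorm_le_norm1 _) _.
by apply: le_trans (ler_norm _) _; exact: hT.
Qed.

Lemma bigO_exp (R : realType) (m k : nat) (u : R -> R) (a : R) :
  bigO u (fun t => iterln m t `^ a) ->
  bigO (fun t => u t ^+ k) (fun t => iterln m t `^ (k%:R * a)).
Proof.
move=> hu; elim: k => [|k IH].
  by rewrite mul0r; apply: bigO_cst.
rewrite (_ : k.+1%:R * a = a + k%:R * a); last by rewrite -natr1 mulrDl mul1r addrC.
apply: bigO_near (bigO_iterlnM hu IH).
by apply: nearW => t; rewrite exprS.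
Qed.

(* The crude bound that starts the bootstrap: here the whole nonlinearity is
   absorbed by the linear part since [y] tends to 0. *)
Lemma a_priori_bound (R : realType) (n : nat) (A : 'M[R]_n)
    (G : 'cV[R]_n -> 'cV[R]_n) (Gm : nat -> 'cV[R]_n -> 'cV[R]_n)
    (f y : R -> 'cV[R]_n) (m : nat) (nu : R) :
  (0 < n)%N -> eigenvalues_pos_real_part A ->
  (forall j, (1 < j)%N -> forall i, hpoly j (fun x => Gm j x i 0)) ->
  (exists r C : R, [/\ 0 < r, 0 < C & forall x, norm1 x <= r -> forall i,
    `|(G x - \sum_(2 <= j < 3) Gm j x) i 0| <= C * norm1 x ^+ 2]) ->
  (\forall t \near +oo, forall i,
    has_deriv (fun x => y x i 0) t ((- (A *m y t) + G (y t) + f t) i 0)) ->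
  y t @[t --> +oo] --> (0 : 'cV[R]_n) ->
  (forall i, bigO (fun t => f t i 0) (fun t => iterln m t `^ (- nu))) ->
  forall i, bigO (fun t => y t i 0) (fun t => iterln m t `^ (- nu)).
Proof.
move=> n0 hA hGm [r [C [r0 C0 hG]]] dy cy hf.
apply: (bigO_stability (h1 := fun t => G (y t)) (h2 := f) n0 hA) => //.
  by apply: filterS dy => t h i; rewrite addrA.
move=> eta eta0.
have : \forall t \near +oo, forall i, `|G (y t) i 0| <= eta * norm1 (y t); last by [].
apply: filter_forall => i.
have [D D0 hD] := hpoly_lipschitz (hGm 2 isT i).
have CD : 0 < C + D by rewrite addr_gt0.
near=> t.
have yr : norm1 (y t) <= r by near: t; exact: cvg0_norm1.
have y1 : norm1 (y t) <= 1 by near: t; exact: cvg0_norm1.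
have ye : norm1 (y t) <= eta / (C + D).
  by near: t; apply: cvg0_norm1 => //; rewrite divr_gt0.
have y0 := norm1_ge0 (y t).
have /= := hG _ yr i; rewrite big_nat1 2!mxE => h1.
have [h2 _] := hD (norm1 (y t)) 0 (y t) (y t) y0 y1
  (@le_norm1 _ _ _) (@le_norm1 _ _ _) (fun j => ltac:(by rewrite subrr normr0)).
apply: le_trans (_ : (C + D) * norm1 (y t) ^+ 2 <= _).
  rewrite mulrDl -[G (y t) i 0](subrK (Gm 2 (y t) i 0)).
  by apply: le_trans (ler_normD _ _) _; exact: lerD.
rewrite expr2 mulrA ler_wpM2r// mulrC -ler_pdivlMr//.
Unshelve. all: by end_near. Qed.

(** The difference w = y - Y solves a linear equation with forcing [h1 + h2]. The first part
    compares one Taylor polynomial at [y] and [Y], and is small relative to w because both tend to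
    0; the second collects the Taylor remainder at [y], the tail of [f] and the residual. The rate
    [nu] enters only through the Taylor remainder. *)
Lemma approx_error (R : realType) (n : nat) (A : 'M[R]_n)
    (G : 'cV[R]_n -> 'cV[R]_n) (Gm : nat -> 'cV[R]_n -> 'cV[R]_n)
    (f y : R -> 'cV[R]_n) (m : nat) (mu : nat -> R) (ns : nat -> nat)
    (p : nat -> R -> 'cV[R]_n) (N : nat) (Y : R -> 'cV[R]_n) (lam nu : R) :
  (0 < n)%N -> eigenvalues_pos_real_part A -> expansion_scale m mu ns ->
  (forall j, (1 < j)%N -> forall i, hpoly j (fun x => Gm j x i 0)) ->
  (exists r C : R, [/\ 0 < r, 0 < C & forall x, norm1 x <= r -> forall i,
    `|(G x - \sum_(2 <= j < N.+3) Gm j x) i 0| <= C * norm1 x ^+ N.+2]) ->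
  (\forall t \near +oo, forall i,
    has_deriv (fun x => y x i 0) t ((- (A *m y t) + G (y t) + f t) i 0)) ->
  y t @[t --> +oo] --> (0 : 'cV[R]_n) ->
  (forall i, bigO (fun t => y t i 0) (fun t => iterln m t `^ (- nu))) ->
  lam <= N.+2%:R * nu -> lam < mu N ->
  (forall i, bigO (fun t => (f t - \sum_(k < N.+1) iterln m t `^ (- mu k) *: p k t) i 0)
    (fun t => iterln m t `^ (- lam))) ->
  approx A Gm m mu ns p N Y ->
  forall i, bigO (fun t => (y t - Y t) i 0) (fun t => iterln m t `^ (- lam)).
Proof.
move=> n0 hA S hGm [r [C [r0 C0 hG]]] dy cy hy lamnu lamN hf [hY [dY [hdY hres]]].
pose fN t := \sum_(k < N.+1) iterln m t `^ (- mu k) *: p k t.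
pose GN x := \sum_(2 <= j < N.+3) Gm j x.
apply: (bigO_stability (h1 := fun t => GN (y t) - GN (Y t))
  (h2 := fun t => (G (y t) - GN (y t)) + (f t - fN t) + residual A Gm m mu p N Y dY t) n0 hA).
- apply: filterS2 dy hdY => t h h' i.
  rewrite (_ : (fun x => _) = fun x => y x i 0 - Y x i 0); last first.
    by apply/funext => x; rewrite mxE [X in _ + X]mxE.
  apply: hder_eq (hderB (h i) (h' i)) _.
  rewrite /residual -/(fN t) -/(GN (Y t)) mulmxBr.
  move: (A *m y t) (A *m Y t) => Ay AY; rewrite !mxE; ring.
- move=> eta eta0; apply: filter_forall => i.
  have Ysmall : forall e, 0 < e -> \forall t \near +oo, norm1 (Y t) <= e.
    move=> e e0; have mu0 := scale_gt0 S 0%N.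
    have h2 : 0 < mu 0%N / 2 by rewrite divr_gt0.
    have hY' : bigO (fun t => norm1 (Y t)) (fun t => iterln m t `^ (- (mu 0%N / 2))).
      apply: bigO_norm1 => [|j]; first by apply: nearW => t; exact: powR_ge0.
      by apply: (gr_bound S (hY j)); lra.
    by apply: filterS (bigO_small h2 e0 hY') => t; apply: le_trans (ler_norm _).
  have /choice[D hD] : forall j, exists D, 0 < D /\ ((1 < j)%N ->
      forall (rho delta : R) (x z : 'cV[R]_n), 0 <= rho -> rho <= 1 ->
      (forall i, `|x i 0| <= rho) -> (forall i, `|z i 0| <= rho) ->
      (forall i, `|x i 0 - z i 0| <= delta) -> 0 <= delta ->
      `|Gm j x i 0 - Gm j z i 0| <= D * rho * delta).
    move=> j; have [j1|j1] := ltnP 1 j; last by exists 1; split=> //; rewrite ltnNge j1.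
    have [D D0 hD] := hpoly_lipschitz (hGm j j1 i); exists D; split=> // _.
    move=> rho delta x z h0 h1 hx hz hxz d0.
    have [_ /(_ d0)] := hD _ _ _ _ h0 h1 hx hz hxz.
    move/le_trans; apply; rewrite ler_wpM2r// ler_pM2l//.
    (* Degrees are at least 2 and [rho <= 1], so rho^(j-1) <= rho. *)
    case: j j1 {hD} => [|[|j]]// _ /=; rewrite exprS ler_piMr// exprn_ile1//.
  pose K := 1 + \sum_(2 <= j < N.+3) D j.
  have K0 : 0 < K by rewrite ltr_pwDl// sumr_ge0// => j _; rewrite ltW// (hD j).1.
  have K2 : 0 < eta / K / 2 by rewrite !divr_gt0.
  near=> t.
  have y1 : norm1 (y t) <= 2^-1 by near: t; apply: cvg0_norm1 => //; rewrite invr_gt0.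
  have Y1 : norm1 (Y t) <= 2^-1 by near: t; apply: Ysmall; rewrite invr_gt0.
  have ye : norm1 (y t) <= eta / K / 2 by near: t; exact: cvg0_norm1.
  have Ye : norm1 (Y t) <= eta / K / 2 by near: t; exact: Ysmall.
  pose rho := norm1 (y t) + norm1 (Y t).
  have y0 := norm1_ge0 (y t); have Y0 := norm1_ge0 (Y t).
  have rho0 : 0 <= rho by rewrite addr_ge0.
  have rho1 : rho <= 1 by rewrite /rho; lra.
  have rhoe : K * rho <= eta by rewrite mulrC -ler_pdivlMr// /rho; lra.
  have w0 := norm1_ge0 (y t - Y t).
  rewrite /GN 2!mxE !summxE -sumrB.
  apply: le_trans (ler_norm_sum _ _ _) _.
  apply: le_trans (_ : \sum_(2 <= j < N.+3) D j * rho * norm1 (y t - Y t) <= _).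
    apply: ler_sum_nat => j /andP[j2 _]; apply: (hD j).2 => //.
    + by move=> k; apply: le_trans (le_norm1 _ _) _; rewrite lerDl.
    + by move=> k; apply: le_trans (le_norm1 _ _) _; rewrite lerDr.
    + by move=> k; apply: le_trans (le_norm1 (y t - Y t) k); rewrite 2!mxE.
  rewrite -mulr_suml -mulr_suml ler_wpM2r//; apply: le_trans rhoe.
  by rewrite ler_wpM2r// lerDr.
- move=> i.
  have h1 : bigO (fun t => (G (y t) - GN (y t)) i 0) (fun t => iterln m t `^ (- lam)).
    have pw0 : \forall t \near +oo, 0 <= iterln m t `^ (- nu).
      by apply: nearW => t; exact: powR_ge0.
    have [D D0 hD] := bigO_exp N.+2 (bigO_norm1 pw0 hy).
    apply: (@bigO_iterln_le _ _ _ (N.+2%:R * - nu)); first by rewrite mulrN lerN2.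
    exists (C * D); first by rewrite mulr_gt0.
    near=> t.
    have yr : norm1 (y t) <= r by near: t; exact: cvg0_norm1.
    apply: le_trans (hG _ yr i) _; rewrite -mulrA ler_pM2l//.
    by apply: le_trans (ler_norm _) _; near: t.
  have h3 := gr_bound S (hres i) (_ : - mu N < - lam).
  apply: bigO_near (bigOD (bigOD h1 (hf i)) (h3 _)); last by rewrite ltrN2.
  by apply: nearW => t; rewrite [RHS]mxE [X in _ = X + _]mxE.
Unshelve. all: by end_near. Qed.

Theorem theorem10p12 (R : realType) (n : nat) (n_gt0 : (0 < n)%N)
    (A : 'M[R]_n) (hA : eigenvalues_pos_real_part A)
    (G : 'cV[R]_n -> 'cV[R]_n) (hG : nonlinearity G)
    (f : R -> 'cV[R]_n) (Tf : R) (Tf_ge0 : 0 <= Tf)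
    (f_cont : {within [set t | 0 < t /\ Tf <= t], continuous f})
    (T0 : R) (T0_ge0 : 0 <= T0) (y : R -> 'cV[R]_n)
    (y_sol : C1_solution A G f T0 y)
    (y_cvg0 : y t @[t --> +oo] --> (0 : 'cV[R]_n))
    (m : nat) (mu : nat -> R)
    (mu_gt0 : forall k, 0 < mu k)
    (mu_incr : increasing_seq mu)
    (mu_div : mu k @[k --> \oo] --> +oo)
    (S_add : forall x x', range mu x -> range mu x' -> range mu (x + x'))
    (S_add1 : m = 0%N -> forall x, range mu x -> range mu (x + 1))
    (ns : nat -> nat)
    (ns_incr : forall k, (ns k <= ns k.+1)%N)
    (ns_ge : forall k, (m <= ns k)%N)
    (phat : forall k, 'rV[R]_(ns k).+2 -> 'cV[R]_n)
    (phat_P1 : forall k, P1 m (phat k))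
    (f_exp : expansion m mu phat f) :
  exists qhat : forall k, 'rV[R]_(ns k).+2 -> 'cV[R]_n,
    (forall k, P1 m (qhat k)) /\ expansion m mu qhat y.
Proof.
have S : expansion_scale m mu ns.
  split=> //.
  - move=> i j; have [k _ ek] := S_add _ _ (ex_intro2 _ _ i I erefl) (ex_intro2 _ _ j I erefl).
    by exists k.
  - by move=> m0 i; have [k _ ek] := S_add1 m0 _ (ex_intro2 _ _ i I erefl); exists k.
  - move=> i j ij; rewrite -(subnK ij); elim: (j - i)%N => [|d IH]; first by rewrite add0n.
    by rewrite addSn; exact: leq_trans IH (ns_incr _).
have [_ [Gm [hGm hT]]] := hG.
have hGp j (j1 : (1 < j)%N) i : hpoly j (fun x => Gm j x i 0) by apply: hpoly_homog; exact: hGm.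
have /choice[p hp] : forall k, exists g : R -> 'cV[R]_n, algv 0 m (ns k) g /\
    \forall t \near +oo, phat k (Lhat (ns k) t) = g t.
  by move=> k; have [g hg eg] := P1_Lhat_algv (phat_P1 k); exists g.
have hpa k : algv 0 m (ns k) (p k) := (hp k).1.
have [q [hq happrox]] := approx_sequence hA S hGp hpa.
(* Agreement with [q k] along Lhat for large t is all that an expansion can see. *)
pose qhat k := sval (cid2 (algv_P1 (hq k))).
have qhatP k : P1 m (qhat k) by rewrite /qhat; case: cid2.
have qhatE k : \forall t \near +oo, qhat k (Lhat (ns k) t) = q k t.
  by rewrite /qhat; case: cid2.
exists qhat; split=> // N.
have mono_mu i j : (i < j)%N -> mu i < mu j.
  by move=> ij; rewrite ltNge (scale_mono S) -ltnNge.
(* Above mu_N as the definition of an expansion demands, and below mu_(N+1) because a residual of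
   rank [N.+1] is bounded only at exponents strictly below it. *)
pose lam := (mu N + mu N.+1) / 2.
have Nlt := mono_mu _ _ (ltnSn N).
have lamN : mu N < lam by rewrite /lam; lra.
have lamN1 : lam < mu N.+1 by rewrite /lam; lra.
exists lam; split=> //.
have f_bigO M i : exists2 a, mu M < a & bigO (fun t => (f t -
    \sum_(k < M.+1) iterln m t `^ (- mu k) *: p k t) i 0) (fun t => iterln m t `^ (- a)).
  have [a [Ma /(O_infty_bigO i) ha]] := f_exp M; exists a => //.
  apply: bigO_near ha.
  have : \forall t \near +oo, forall k : 'I_M.+1, phat k (Lhat (ns k) t) = p k t.
    by apply: filter_forall => k; exact: (hp k).2.
  by apply: filterS => t ht; under eq_bigr => k _ do rewrite ht.
(* The Taylor remainder at order [N.+1] has degree N+3, so this rate suffices for [y]. It is below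
   mu_0 because lam < mu_(N+2) <= (N+3) mu_0, so [f] decays at this rate and hence so does [y]. *)
pose nu := lam / N.+3%:R.
have nu_mu0 : nu < mu 0%N.
  rewrite ltr_pdivrMr// mulrC.
  apply: lt_le_trans (scale_mul_ge N.+2 S); exact: lt_trans (mono_mu _ _ (ltnSn _)).
have hdy := C1_solution_deriv y_sol.
have hy i : bigO (fun t => y t i 0) (fun t => iterln m t `^ (- nu)).
  apply: (a_priori_bound n_gt0 hA hGp _ hdy y_cvg0); first exact: taylor_norm1 (hT 2 isT).
  move=> j; have [a mua ha] := f_bigO 0%N j.
  have ha' := bigO_iterln_le (_ : - a <= - nu) ha.
  have hb := gr_bound S (gr_term mu (leqnn 0) (hpa 0%N j)) (_ : - mu 0%N < - nu).
  apply: bigO_near (bigOD (ha' _) (hb _)); [|by rewrite lerN2; lra|by rewrite ltrN2].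
  apply: nearW => t; rewrite big_ord_recl big_ord0 addr0 !mxE subrK//.
have hN : forall i, bigO (fun t => (y t - \sum_(k < N.+1) iterln m t `^ (- mu k) *: q k t) i 0)
    (fun t => iterln m t `^ (- lam)).
  apply: (approx_error n_gt0 hA S hGp (taylor_norm1 (hT N.+3 isT)) hdy y_cvg0 hy
    _ lamN1 _ (happrox N.+1)).
  - by rewrite /nu mulrC divfK ?pnatr_eq0.
  - move=> i; have [a ha] := f_bigO N.+1 i; apply: bigO_iterln_le; rewrite lerN2; lra.
apply: bigO_O_infty => [|i]; first by apply: nearW => t; exact: powR_ge0.
apply: bigO_near (hN i).
have : \forall t \near +oo, forall k : 'I_N.+1, qhat k (Lhat (ns k) t) = q k t.
  by apply: filter_forall => k; exact: qhatE.
by apply: filterS => t ht; under [in RHS]eq_bigr => k _ do rewrite ht.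
Qed.
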